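(* Let $\mathbf A$ be a full subcategory of $\mathrm{Def}$ such that every definably compact definable subset of an object of $\mathbf A$ is a closed subset. Suppose that the set of objects of $\mathbf A$ is closed under taking locally closed definable subsets of objects of $\mathbf A$ and closed under taking cartesian products of objects of $\mathbf A$. In the category $\mathbf A$ the following hold: (1) Closed immersions are definably proper. (2) A composition of two definably proper morphisms is definably proper. (3) Let $p:X\to Z$, $q:Y\to Z$ and $f:X\to Y$ be morphisms in $\mathbf A$ with $q\circ f=p$, and let $Z'\to Z$ be a morphism in $\mathbf A$. If $f$ is definably proper, then the base extension morphism $f'=f\times\mathrm{id}_{Z'}:X\times_Z Z'\to Y\times_Z Z'$ is definably proper. (4) Let $p:X\to Z$, $q:Y\to Z$, $f:X\to Y$ with $q\circ f=p$, and $p':X'\to Z$, $q':Y'\to Z$, $f':X'\to Y'$ with $q'\circ f'=p'$, be morphisms in $\mathbf A$. If $f$ and $f'$ are definably proper, then the product morphism $f\times f':X\times_Z X'\to Y\times_Z Y'$ is definably proper. (5) If $f:X\to Y$ and $g:Y\to Z$ are morphisms such that $g\circ f$ is definably proper, then: (i) $f$ is definably proper; (ii) if $\mathbb M$ has definable Skolem functions, then $g_{|f(X)}:f(X)\to Z$ is definably proper. (6) A morphism $f:X\to Y$ is definably proper if and only if $Y$ can be covered by finitely many open definable subsets $V_i$ such that each restriction $f_|:f^{-1}(V_i)\to V_i$ is definably proper.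
   Context: $\mathbb M=(M,<,\ldots)$ is an o-minimal structure; ''definable'' means definable in $\mathbb M$, possibly with parameters. $\mathbb M$ has definable Skolem functions if for every uniformly definable family $\{F_t\}_{t\in T}$ of nonempty definable sets there is a definable map $f:T\to\bigcup_t F_t$ with $f(t)\in F_t$ for all $t\in T$. A definable space is a set $X=\bigcup_{i\le k}X_i$ with injections (definable charts) $\theta_i:X_i\to M^{n_i}$ ($i\le k$, $k$ finite) such that each $\theta_i(X_i)$ is a definable subset of $M^{n_i}$ (with the induced topology), each $\theta_i(X_i\cap X_j)$ is an open definable subset of $\theta_i(X_i)$, and each transition map $\theta_j\circ\theta_i^{-1}:\theta_i(X_i\cap X_j)\to\theta_j(X_i\cap X_j)$ is a definable homeomorphism. $X$ carries the topology in which each $X_i$ is open and each $\theta_i$ is a homeomorphism. A subset $A\subseteq X$ is definable if each $\theta_i(A\cap X_i)$ is definable; it is then itself a definable space with the induced topology. A map $f:X\to Y$ between definable spaces with charts $(X_i,\theta_i)$, $(Y_j,\delta_j)$ is definable if each $\delta_j\circ f\circ\theta_i^{-1}$ (on its natural domain) is a definable map between definable sets. $\mathrm{Def}$ is the category of definable spaces with continuous definable maps. For $f:X\to Z$, $g:Y\to Z$ in $\mathrm{Def}$, $X\times_Z Y=\{\langle x,y\rangle\in X\times Y: f(x)=g(y)\}$ is the fiber product. A morphism $f:X\to Y$ is a closed immersion if $f:X\to f(X)$ is a homeomorphism and $f(X)$ is closed in $Y$. A definable curve in a definable subset $C\subseteq X$ is a continuous definable map $\alpha:(a,b)\to C$,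 with $a<b$ in $M\cup\{-\infty,+\infty\}$; it is completable in $C$ if both limits $\lim_{t\to a^+}\alpha(t)$ and $\lim_{t\to b^-}\alpha(t)$ exist in $C$. $C$ is definably compact if every definable curve in $C$ is completable in $C$. A continuous definable map $f:X\to Y$ is definably proper if $f^{-1}(K)$ is a definably compact definable subset of $X$ for every definably compact definable subset $K$ of $Y$. *)

(* Defs.v *)
From HB Require Import structures.
From mathcomp Require Import all_boot all_order all_algebra.
From mathcomp Require Import boolp classical_sets functions set_interval filter topology.

Set Implicit Arguments.
Unset Strict Implicit.
Unset Printing Implicit Defensive.

Import Order.TTheory.

Local Open Scope classical_set_scope.

(* First-order structures expanding an ordered set [M]. The order symbol is    *)
(* built into the formulas, together with equality.                           *)
Record fo_structure (M : Type) := FoStructure {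
  fsym : Type;
  farity : fsym -> nat;
  finterp : forall f : fsym, ('I_(farity f) -> M) -> M;
  rsym : Type;
  rarity : rsym -> nat;
  rinterp : forall r : rsym, ('I_(rarity r) -> M) -> Prop
}.

Section Definability.
Variables (d : Order.disp_t) (M : orderTopologicalType d) (S : fo_structure M).

Inductive term (n : nat) : Type :=
  | Tvar of 'I_n
  | Tpar of M
  | Tapp (f : fsym S) of ('I_(farity f) -> term n).

Inductive formula : nat -> Type :=
  | FLt n of term n & term n : formula n
  | FEq n of term n & term n : formula n
  | FRel n (r : rsym S) of ('I_(rarity r) -> term n) : formula n
  | FNot n of formula n : formula n
  | FAnd n of formula n & formula n : formula n
  | FEx n of formula n.+1 : formula n.

Definition scons n (a : M) (v : 'I_n -> M) : 'I_n.+1 -> M :=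
  fun i => oapp v a (unlift ord0 i).

Fixpoint eval n (v : 'I_n -> M) (t : term n) : M :=
  match t with
  | Tvar i => v i
  | Tpar a => a
  | Tapp f ts => finterp (fun k => eval v (ts k))
  end.

(* De Bruijn convention: [FEx phi] binds the variable [ord0] of [phi]. *)
Fixpoint sat n (phi : formula n) : ('I_n -> M) -> Prop :=
  match phi with
  | FLt _ t u => fun v => (eval v t < eval v u)%O
  | FEq _ t u => fun v => eval v t = eval v u
  | FRel _ r ts => fun v => rinterp (fun k => eval v (ts k))
  | FNot _ p => fun v => ~ sat p v
  | FAnd _ p q => fun v => sat p v /\ sat q v
  | FEx _ p => fun v => exists a, sat p (scons a v)
  end.

Definition definable n (A : set 'rV[M]_n) : Prop :=
  exists phi : formula n, forall x, A x <-> sat phi (x ord0).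

Definition graph_on n m (A : set 'rV[M]_n) (g : 'rV[M]_n -> 'rV[M]_m) :
  set 'rV[M]_(n + m) := [set row_mx x (g x) | x in A].

Definition definable_map n m (A : set 'rV[M]_n) (g : 'rV[M]_n -> 'rV[M]_m) :=
  definable (graph_on A g).

(* Dense linear order without endpoints, in which every definable subset of M  *)
(* is a finite union of points and open intervals with endpoints in M or -oo, *)
(* +oo.                                                                       *)
Definition o_minimal : Prop :=
  [/\ [set: M] !=set0,
      forall x y : M, (x < y)%O -> exists z, (x < z < y)%O,
      forall x : M, (exists y, (y < x)%O) /\ (exists y, (x < y)%O) &
      forall A : set M, definable [set x : 'rV[M]_1 | A (x ord0 ord0)] ->
        exists (P : seq M) (I : seq (interval M)),
          all itv_open_ends I /\
          A = [set x | x \in P \/ has (fun i => x \in i) I]].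

Definition definable_skolem : Prop :=
  forall n m (T : set 'rV[M]_n) (F : set 'rV[M]_(n + m)),
    definable T -> definable F ->
    (forall t, T t -> exists y, F (row_mx t y)) ->
    exists f : 'rV[M]_n -> 'rV[M]_m,
      definable_map T f /\ forall t, T t -> F (row_mx t (f t)).

Definition rel_open n (A B : set 'rV[M]_n) : Prop :=
  exists2 W, open W & B = A `&` W.

(* Maps between subsets of M^n and M^m are represented by total functions of   *)
(* which only the values on the relevant set matter.                          *)
Definition definable_homeo n m (A : set 'rV[M]_n) (B : set 'rV[M]_m)
    (g : 'rV[M]_n -> 'rV[M]_m) : Prop :=
  [/\ definable_map A g, g @` A = B, {within A, continuous g} &
      exists2 h : 'rV[M]_m -> 'rV[M]_n,
        {within B, continuous h} & forall x, A x -> h (g x) = x].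

End Definability.

Section DefinabilityClosure.
Variables (d : Order.disp_t) (M : orderTopologicalType d) (S : fo_structure M).
Local Notation definable := (definable S).

Fixpoint term_ren n m (h : 'I_n -> 'I_m) (t : term S n) : term S m :=
  match t with
  | Tvar i => Tvar S (h i)
  | Tpar a => Tpar S m a
  | Tapp f ts => Tapp (fun k => term_ren h (ts k))
  end.

Definition up_ren n m (h : 'I_n -> 'I_m) : 'I_n.+1 -> 'I_m.+1 :=
  fun i => oapp (fun k => lift ord0 (h k)) ord0 (unlift ord0 i).

Fixpoint form_ren n (phi : formula S n) : forall m, ('I_n -> 'I_m) -> formula S m :=
  match phi with
  | FLt _ t u => fun _ h => FLt (term_ren h t) (term_ren h u)
  | FEq _ t u => fun _ h => FEq (term_ren h t) (term_ren h u)
  | FRel _ r ts => fun _ h => FRel (fun k => term_ren h (ts k))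
  | FNot _ p => fun _ h => FNot (form_ren p h)
  | FAnd _ p q => fun _ h => FAnd (form_ren p h) (form_ren q h)
  | FEx _ p => fun _ h => FEx (form_ren p (up_ren h))
  end.

Lemma eval_ren n m (h : 'I_n -> 'I_m) (t : term S n) v :
  eval v (term_ren h t) = eval (v \o h) t.
Proof.
by elim: t => //= f ts IH; congr (finterp _); apply: funext. Qed.

Lemma scons_up n m (h : 'I_n -> 'I_m) (a : M) v :
  scons a v \o up_ren h = scons a (v \o h).
Proof.
apply/funext => i; rewrite /scons /up_ren /=.
by case: (unliftP ord0 i) => [j|] _ /=; rewrite ?liftK ?unlift_none.
Qed.

Lemma sat_ren n (phi : formula S n) m (h : 'I_n -> 'I_m) v :
  sat (form_ren phi h) v <-> sat phi (v \o h).
Proof.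
elim: phi m h v => {n} /= [n t u|n t u|n r ts|n p IH|n p IHp q IHq|n p IH] m h v.
- by rewrite !eval_ren.
- by rewrite !eval_ren.
- suff -> : (fun k => eval v (term_ren h (ts k))) =
            (fun k => eval (v \o h) (ts k)) by [].
  by apply/funext => k; rewrite eval_ren.
- by rewrite IH.
- by rewrite IHp IHq.
- by split=> -[a]; [rewrite IH scons_up|rewrite -scons_up -IH]; exists a.
Qed.

Lemma definable_ext n (A B : set 'rV[M]_n) :
  (forall x, A x <-> B x) -> definable A -> definable B.
Proof. by move=> AB [p hp]; exists p => x; rewrite -AB. Qed.

Lemma definable_colsub n m (h : 'I_n -> 'I_m) (A : set 'rV[M]_n) :
  definable A -> definable [set x : 'rV[M]_m | A (colsub h x)].
Proof.
move=> [p hp]; exists (form_ren p h) => x; rewrite sat_ren /= hp.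
by have -> : colsub h x ord0 = x ord0 \o h by apply/funext => i; rewrite mxE.
Qed.

Lemma definableI n (A B : set 'rV[M]_n) :
  definable A -> definable B -> definable (A `&` B).
Proof. by move=> [p hp] [q hq]; exists (FAnd p q) => x /=; rewrite -hp -hq. Qed.

Lemma definableU n (A B : set 'rV[M]_n) :
  definable A -> definable B -> definable (A `|` B).
Proof.
move=> [p hp] [q hq]; exists (FNot (FAnd (FNot p) (FNot q))) => x /=.
by rewrite -hp -hq not_andE !not_notE.
Qed.

Lemma definable0 n : definable (set0 : set 'rV[M]_n).
Proof.
case: n => [|n].
- case: (pselect (inhabited M)) => [[a]|noM].
    by exists (FNot (FEq (Tpar S 0 a) (Tpar S 0 a))) => x /=; split=> // -[].
  exists (FEx (FEq (Tvar S ord0) (Tvar S ord0))) => x /=.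
  by split=> // -[a _]; apply: noM.
- by exists (FNot (FEq (Tvar S ord0) (Tvar S ord0))) => x /=; split=> // -[].
Qed.

Lemma definable_bigU n (I : finType) (F : I -> set 'rV[M]_n) :
  (forall i, definable (F i)) -> definable (\bigcup_i F i).
Proof.
move=> hF; suff H (s : seq I) : definable [set x | exists2 i, i \in s & F i x].
  apply: definable_ext (H (enum I)) => x.
  by split=> -[i _ Fx]; exists i => //; rewrite mem_enum.
elim: s => [|i s IH].
  by apply: definable_ext (definable0 n) => x; split=> // -[].
apply: definable_ext (definableU (hF i) IH) => x; split.
  by case=> [?|[j js ?]]; [exists i|exists j]; rewrite // inE ?eqxx // js orbT.
by case=> j; rewrite inE => /predU1P[->|js] Fx; [left|right; exists j].
Qed.

Lemma definable_ex n m (A : set 'rV[M]_(n + m)) :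
  definable A -> definable [set x | exists y, A (row_mx x y)].
Proof.
pose cc k l (w : 'I_l -> M) (v : 'I_k -> M) (i : 'I_(l + k)) : M :=
  match fintype.split i with inl j => w j | inr j => v j end.
have exs k : forall p : formula S (k + n), exists q : formula S n,
    forall v, sat q v <-> exists w, sat p (cc n k w v).
  elim: k => [|k IH] p.
    exists p => v; have e w : cc n 0 w v = v.
      apply/funext => i; rewrite /cc; case: fintype.splitP => [[]//|j /= ij].
      by congr v; apply/val_inj.
    have w0 : 'I_0 -> M by case.
    by split=> [h|[w]]; [exists w0|]; rewrite e.
  have [q hq] := IH (FEx p : formula S (k + n)); exists q => v; rewrite hq /=.
  have e a w : scons a (cc n k w v) = cc n k.+1 (scons a w) v.
    apply/funext => i; rewrite /scons /cc.
    case: (unliftP ord0 i) => [j ->|->] /=.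
      case: fintype.splitP => j' ej; case: fintype.splitP => l el;
        rewrite /= in ej el; rewrite [bump _ _]add1n in el.
      - have -> : l = lift ord0 j' by apply/val_inj; rewrite /= -ej -[LHS]el.
        by rewrite liftK.
      - by have := ltn_ord j'; rewrite -ej -ltnS el ltnNge leq_addr.
      - by have := ltn_ord l; rewrite -el ej ltnS ltnNge leq_addr.
      - congr v; apply/val_inj/eqP; move/eqP: el.
        by rewrite ej addSn eqSS eqn_add2l.
    case: fintype.splitP => l /= el; last by [].
    have -> : l = ord0 by apply/val_inj.
    by rewrite unlift_none.
  split=> [[w [a h]]|[w h]]; first by exists (scons a w); rewrite -e.
  exists (w \o lift ord0), (w ord0); rewrite e; congr (sat p): h.
  congr cc; apply/funext => i; rewrite /scons.
  by case: unliftP => [j|] ->.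
move=> [p hp].
pose h (i : 'I_(n + m)) : 'I_(m + n) :=
  match fintype.split i with inl j => rshift m j | inr j => lshift n j end.
have [q hq] := exs m (form_ren p h); exists q => x; rewrite hq /=.
have e w : cc n m w (x ord0) \o h = row_mx x (\row_j w j) ord0.
  apply/funext => i; rewrite /cc /h /= mxE.
  by case: (fintype.splitP i) => j _; rewrite ?mxE;
    [rewrite (unsplitK (inr j))|rewrite (unsplitK (inl j))].
split=> [[y]|[w]].
  rewrite hp => hy; exists (y ord0); rewrite sat_ren e.
  by have -> : (\row_j y ord0 j)%R = y by apply/rowP => j; rewrite mxE.
by rewrite sat_ren e -hp; exists (\row_j w j)%R.
Qed.

Definition is_colsub N n (f : 'rV[M]_N -> 'rV[M]_n) : Prop :=
  exists h, forall z, f z = colsub h z.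

Lemma is_colsub_id n : is_colsub (fun z : 'rV[M]_n => z).
Proof. by exists id => z; apply/rowP => i; rewrite mxE. Qed.

Lemma is_colsub_lsub N n m (f : 'rV[M]_N -> 'rV[M]_(n + m)) :
  is_colsub f -> is_colsub (fun z => lsubmx (f z)).
Proof. by move=> [h hf]; exists (h \o lshift m) => z; apply/rowP => i; rewrite !mxE hf mxE. Qed.

Lemma is_colsub_rsub N n m (f : 'rV[M]_N -> 'rV[M]_(n + m)) :
  is_colsub f -> is_colsub (fun z => rsubmx (f z)).
Proof. by move=> [h hf]; exists (h \o @rshift n m) => z; apply/rowP => i; rewrite !mxE hf mxE. Qed.

Lemma is_colsub_row N n m (f : 'rV[M]_N -> 'rV[M]_n) (g : 'rV[M]_N -> 'rV[M]_m) :
  is_colsub f -> is_colsub g -> is_colsub (fun z => row_mx (f z) (g z)).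
Proof.
move=> [h hf] [k hg].
exists (fun i => match fintype.split i with inl j => h j | inr j => k j end) => z.
by apply/rowP => i; rewrite !mxE; case: (fintype.splitP i) => j _; rewrite ?hf ?hg mxE.
Qed.

Lemma definable_pre N n (f : 'rV[M]_N -> 'rV[M]_n) (A : set 'rV[M]_n) :
  is_colsub f -> definable A -> definable [set z | A (f z)].
Proof.
move=> [h hf] /(definable_colsub h); apply: definable_ext => z.
by rewrite /= hf.
Qed.

Definition rowprod n m (A : set 'rV[M]_n) (B : set 'rV[M]_m) : set 'rV[M]_(n + m) :=
  [set z | A (lsubmx z) /\ B (rsubmx z)].

Lemma definable_rowprod n m (A : set 'rV[M]_n) (B : set 'rV[M]_m) :
  definable A -> definable B -> definable (rowprod A B).
Proof.
move=> dA dB; apply: definableI.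
  exact: (definable_pre (is_colsub_lsub (@is_colsub_id _)) dA).
exact: (definable_pre (is_colsub_rsub (@is_colsub_id _)) dB).
Qed.

Lemma definable_exl n m (A : set 'rV[M]_(n + m)) :
  definable A -> definable [set y | exists x, A (row_mx x y)].
Proof.
move=> dA; have := definable_ex (definable_pre
  (is_colsub_row (is_colsub_rsub (@is_colsub_id (m + n))) (is_colsub_lsub (@is_colsub_id _))) dA).
by apply: definable_ext => y /=; split=> -[x]; rewrite ?row_mxKl ?row_mxKr => h; exists x;
  rewrite ?row_mxKl ?row_mxKr.
Qed.

End DefinabilityClosure.

Section RelativeTopology.
Variables (d : Order.disp_t) (M : orderTopologicalType d) (S : fo_structure M).
Local Notation definable := (definable S).

Lemma lsubmx_continuous n m : continuous (fun z : 'rV[M]_(n + m) => lsubmx z).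
Proof.
move=> z A [P zP PA]; exists (fun i j => match fintype.split j with
    | inl k => P i k | inr k => setT end) => [i j|y yP].
  case: (fintype.splitP j) => k jk; last exact: filterT.
  by have := zP i k; rewrite mxE; congr (nbhs (z i _) _); apply/val_inj.
apply: PA => i j; have := yP i (lshift m j).
by rewrite (unsplitK (inl j)) mxE.
Qed.

Lemma rsubmx_continuous n m : continuous (fun z : 'rV[M]_(n + m) => rsubmx z).
Proof.
move=> z A [P zP PA]; exists (fun i j => match fintype.split j with
    | inl k => setT | inr k => P i k end) => [i j|y yP].
  case: (fintype.splitP j) => k jk; first exact: filterT.
  by have := zP i k; rewrite mxE; congr (nbhs (z i _) _); apply/val_inj.
apply: PA => i j; have := yP i (rshift n j).
by rewrite (unsplitK (inr j)) mxE.
Qed.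

Lemma cvg_row_mx n m (T : Type) (F : set_system T) (FF : Filter F)
    (f : T -> 'rV[M]_n) (g : T -> 'rV[M]_m) (a : 'rV[M]_n) (b : 'rV[M]_m) :
  f @ F --> a -> g @ F --> b -> (fun t => row_mx (f t) (g t)) @ F --> row_mx a b.
Proof.
move=> fa gb A [P abP PA].
have h1 : (f @ F) [set y | forall i j, P i (lshift m j) (y i j)].
  apply: fa; exists (fun i j => P i (lshift m j)) => // i j.
  by have := abP i (lshift m j); rewrite row_mxEl.
have h2 : (g @ F) [set y | forall i j, P i (rshift n j) (y i j)].
  apply: gb; exists (fun i j => P i (rshift n j)) => // i j.
  by have := abP i (rshift n j); rewrite row_mxEr.
apply: (@filterS _ F FF _ _ _ (@filterI _ F FF _ _ h1 h2)) => t [/= t1 t2]; apply: PA => i j.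
by rewrite mxE; case: fintype.splitP => k jk;
  [have := t1 i k|have := t2 i k]; congr (P i _ _); apply/val_inj.
Qed.

Lemma within_prod n m n' m' (A : set 'rV[M]_n) (B : set 'rV[M]_m)
    (g : 'rV[M]_n -> 'rV[M]_n') (k : 'rV[M]_m -> 'rV[M]_m') :
  {within A, continuous g} -> {within B, continuous k} ->
  {within rowprod A B, continuous (fun z => row_mx (g (lsubmx z)) (k (rsubmx z)))}.
Proof.
move=> /subspace_continuousP cg /subspace_continuousP ck.
apply/subspace_continuousP => z [Az Bz]; apply: cvg_row_mx.
  move=> U /(cg _ Az) /(@lsubmx_continuous _ _ z) h.
  by apply: (@filterS _ (nbhs z) _ _ _ _ h) => y yU [Ay _]; exact: yU.
move=> U /(ck _ Bz) /(@rsubmx_continuous _ _ z) h.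
by apply: (@filterS _ (nbhs z) _ _ _ _ h) => y yU [_ By]; exact: yU.
Qed.

Lemma rel_open_prod n m (A A' : set 'rV[M]_n) (B B' : set 'rV[M]_m) :
  rel_open A A' -> rel_open B B' -> rel_open (rowprod A B) (rowprod A' B').
Proof.
move=> [W oW ->] [W' oW' ->].
exists ((fun z => lsubmx z) @^-1` W `&` (fun z => rsubmx z) @^-1` W').
  by apply: openI; apply: open_comp => // z _;
    [exact: lsubmx_continuous|exact: rsubmx_continuous].
by apply/seteqP; split=> z /= [[? ?] [? ?]].
Qed.

Lemma homeo_restr n m (A A' : set 'rV[M]_n) (B B' : set 'rV[M]_m) g :
  definable_homeo S A B g -> A' `<=` A -> definable A' -> g @` A' = B' ->
  definable_homeo S A' B' g.
Proof.
move=> [dg gA cg [h ch hg]] A'A dA' gA'; split=> //.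
- have := definableI dg (definable_pre (is_colsub_lsub (@is_colsub_id _ _ (n + m))) dA').
  apply: definable_ext => z; split=> [[[x Ax <-]]|[x A'x <-]] /=.
    by rewrite row_mxKl => A'x; exists x.
  by split; [exists x => //; exact: A'A|rewrite row_mxKl].
- exact: continuous_subspaceW cg.
- exists h => [|x /A'A /hg //]; apply: continuous_subspaceW ch.
  by rewrite -gA -gA'; apply: image_subset.
Qed.

Lemma homeo_prod n m n' m' (A : set 'rV[M]_n) (A' : set 'rV[M]_n')
    (B : set 'rV[M]_m) (B' : set 'rV[M]_m') g k :
  definable_homeo S A A' g -> definable_homeo S B B' k ->
  definable_homeo S (rowprod A B) (rowprod A' B')
    (fun z => row_mx (g (lsubmx z)) (k (rsubmx z))).
Proof.
move=> [dg gA cg [h ch hg]] [dk kB ck [l cl lk]]; split.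
- have L := is_colsub_lsub (@is_colsub_id _ M ((n + m) + (n' + m'))).
  have R := is_colsub_rsub (@is_colsub_id _ M ((n + m) + (n' + m'))).
  have dl := definable_pre (is_colsub_row (is_colsub_lsub L) (is_colsub_lsub R)) dg.
  have dr := definable_pre (is_colsub_row (is_colsub_rsub L) (is_colsub_rsub R)) dk.
  apply: definable_ext (definableI dl dr) => z; split.
    move=> [[x Ax /eq_row_mx [ex ex']] [y By /eq_row_mx [ey ey']]].
    exists (lsubmx z) => /=; first by split; rewrite -?ex -?ey.
    by rewrite -ex -ey ex' ey' !hsubmxK.
  move=> [x [Ax Bx] <-]; split; rewrite /= !(row_mxKl, row_mxKr).
    by exists (lsubmx x).
  by exists (rsubmx x).
- rewrite -gA -kB; apply/seteqP; split=> [_ [z [Az Bz] <-]|z [[x Ax ex] [y By ey]]].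
    by split; rewrite ?row_mxKl ?row_mxKr; [exists (lsubmx z)|exists (rsubmx z)].
  exists (row_mx x y); first by split; rewrite ?row_mxKl ?row_mxKr.
  by rewrite row_mxKl row_mxKr ex ey hsubmxK.
- exact: within_prod.
- exists (fun z => row_mx (h (lsubmx z)) (l (rsubmx z))); first exact: within_prod.
  by move=> z [Az Bz]; rewrite row_mxKl row_mxKr hg // lk // hsubmxK.
Qed.

End RelativeTopology.

Section DefinableSpaces.
Variables (d : Order.disp_t) (M : orderTopologicalType d) (S : fo_structure M).
Local Notation definable := (definable S).

(* The charts are total functions of which only the values on [ddom i] matter. *)
Record defspace := DefSpace {
  dcarrier : choiceType;
  dindex : finType;
  ddim : dindex -> nat;
  ddom : dindex -> set dcarrier;
  dchart : forall i, dcarrier -> 'rV[M]_(ddim i);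
  dcover : forall x, exists i, ddom i x;
  dchart_inj : forall i x y,
    ddom i x -> ddom i y -> dchart i x = dchart i y -> x = y;
  ddef : forall i, definable (dchart i @` ddom i);
  doverlap_def : forall i j, definable (dchart i @` (ddom i `&` ddom j));
  doverlap_open : forall i j,
    rel_open (dchart i @` ddom i) (dchart i @` (ddom i `&` ddom j));
  dtransition : forall i j, exists2 g,
    (forall x, (ddom i `&` ddom j) x -> g (dchart i x) = dchart j x) &
    definable_homeo S (dchart i @` (ddom i `&` ddom j))
                      (dchart j @` (ddom i `&` ddom j)) g
}.

Definition pt (X : defspace) : Type := dcarrier X.
Coercion pt : defspace >-> Sortclass.
HB.instance Definition _ (X : defspace) := Choice.on (pt X).

(* The topology in which every X_i is open and every chart is a homeomorphism  *)
(* onto its image: U is open iff each theta_i(U `&` X_i) is open in           *)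
(* theta_i(X_i).                                                              *)
Definition dopen (X : defspace) (U : set X) : Prop :=
  forall i, rel_open (dchart i @` ddom i) (dchart i @` (U `&` @ddom X i)).

Lemma dopenT (X : defspace) : dopen [set: X].
Proof. by move=> i; exists setT; [exact: openT|rewrite setTI setIT]. Qed.

Lemma dopenI (X : defspace) : setI_closed (@dopen X).
Proof.
move=> U V oU oV i; have [W oW eW] := oU i; have [W' oW' eW'] := oV i.
exists (W `&` W'); first exact: openI.
apply/seteqP; split=> [_ [x [[Ux Vx] Dx] <-]|z [[x Dx <-] [Wx Wx']]].
  have : (dchart i @` ddom i `&` W) (dchart i x) by rewrite -eW; exists x.
  have : (dchart i @` ddom i `&` W') (dchart i x) by rewrite -eW'; exists x.
  by move=> [? ?] [? ?].
have : (dchart i @` (U `&` ddom i)) (dchart i x) by rewrite eW; split=> //; exists x.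
have : (dchart i @` (V `&` ddom i)) (dchart i x) by rewrite eW'; split=> //; exists x.
move=> [y [Vy Dy] /(dchart_inj Dy Dx) ey] [y' [Uy Dy'] /(dchart_inj Dy' Dx) ey'].
by subst y y'; exists x.
Qed.

Lemma dopen_bigU (X : defspace) (I : Type) (f : I -> set X) :
  (forall i, dopen (f i)) -> dopen (\bigcup_i f i).
Proof.
move=> of_ i.
have /boolp.choice[W hW] : forall k, exists W, open W /\
    dchart i @` (f k `&` ddom i) = dchart i @` ddom i `&` W.
  by move=> k; have [W ? ?] := of_ k i; exists W.
exists (\bigcup_k W k); first by apply: bigcup_open => k _; case: (hW k).
rewrite setI_bigcupr setI_bigcupl.
apply/seteqP; split=> [_ [x [k _ [fx Dx]] <-]|z [k _]].
  by exists k => //; rewrite -(hW k).2; exists x.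
by rewrite -(hW k).2 => -[x [fx Dx] <-]; exists x => //; exists k.
Qed.

HB.instance Definition _ (X : defspace) :=
  isOpenTopological.Build (pt X) (@dopenT X) (@dopenI X) (@dopen_bigU X).

Lemma dopenE (X : defspace) (U : set X) : open U = dopen U.
Proof. by []. Qed.

Definition is_definable (X : defspace) (A : set X) : Prop :=
  forall i, definable (dchart i @` (A `&` @ddom X i)).

Record dset (X : defspace) := DSet {
  dset_set :> set X;
  dset_def : is_definable dset_set
}.

(* A definable subset, as a definable space with the restricted charts.        *)
Section Subspace.
Variables (X : defspace) (D : dset X).

Definition sub_dom (i : dindex X) : set (set_type D) := [set x | ddom i (val x)].
Definition sub_chart (i : dindex X) (x : set_type D) := dchart i (val x : X).

Lemma sub_image i (P : set X) :
  sub_chart i @` [set x | P (val x)] = dchart i @` (D `&` P).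
Proof.
apply/seteqP; split=> [_ [x Px <-]|_ [x [Dx Px] <-]].
  by exists (val x) => //; split=> //; exact: set_mem (valP x).
by exists (SigSub (mem_set Dx)).
Qed.

Lemma sub_image_overlap i j : sub_chart i @` (sub_dom i `&` sub_dom j) =
  dchart i @` (D `&` ddom i) `&` dchart i @` (@ddom X i `&` ddom j).
Proof.
rewrite (sub_image i (ddom i `&` ddom j)).
apply/seteqP; split=> [_ [x [Dx [xi xj]] <-]|_ [[x [Dx xi] <-] [y [yi yj]]]].
  by split; exists x.
by move=> /(dchart_inj yi xi) yx; subst y; exists x.
Qed.

Lemma sub_cover x : exists i, sub_dom i x.
Proof. exact: dcover. Qed.

Lemma sub_chart_inj i x y : sub_dom i x -> sub_dom i y ->
  sub_chart i x = sub_chart i y -> x = y.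
Proof. by move=> xi yi /(dchart_inj xi yi)/val_inj. Qed.

Lemma sub_def i : definable (sub_chart i @` sub_dom i).
Proof. by rewrite (sub_image i (ddom i)); exact: dset_def. Qed.

Lemma sub_overlap_def i j : definable (sub_chart i @` (sub_dom i `&` sub_dom j)).
Proof.
by rewrite sub_image_overlap; apply: definableI; [exact: dset_def|exact: doverlap_def].
Qed.

Lemma sub_overlap_open i j :
  rel_open (sub_chart i @` sub_dom i) (sub_chart i @` (sub_dom i `&` sub_dom j)).
Proof.
rewrite sub_image_overlap (sub_image i (ddom i)).
have [W oW ->] := doverlap_open i j; exists W => //.
rewrite setIA; congr (_ `&` W); apply/setIidPl => _ [x [_ xi] <-].
by exists x.
Qed.

Lemma sub_transition i j : exists2 g,
  (forall x, (sub_dom i `&` sub_dom j) x -> g (sub_chart i x) = sub_chart j x) &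
  definable_homeo S (sub_chart i @` (sub_dom i `&` sub_dom j))
                    (sub_chart j @` (sub_dom i `&` sub_dom j)) g.
Proof.
have [g gE hg] := dtransition i j; exists g => [x ?|]; first exact: gE.
apply: homeo_restr hg _ (sub_overlap_def i j) _.
  by rewrite sub_image_overlap; exact: subIsetr.
apply/seteqP; split=> [_ [_ [x xij <-] <-]|_ [x xij <-]].
  by exists x => //; rewrite [RHS]gE.
by exists (sub_chart i x); [exists x|exact: gE].
Qed.

Definition dsub : defspace :=
  @DefSpace (set_type D) (dindex X) (@ddim X) sub_dom sub_chart sub_cover
    sub_chart_inj sub_def sub_overlap_def sub_overlap_open sub_transition.

Definition sub_val (x : dsub) : X := val (x : set_type D).
Definition sub_in (x : X) (Dx : dset_set D x) : dsub := SigSub (mem_set Dx).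

Lemma sub_valP (x : dsub) : dset_set D (sub_val x).
Proof. exact: set_mem (valP (x : set_type D)). Qed.

(* The topology of [dsub] is the induced one. *)
Lemma open_subE (U : set dsub) :
  open U <-> exists2 V : set X, open V & U = sub_val @^-1` V.
Proof.
have imE i (V : set X) : sub_chart i @` (sub_val @^-1` V `&` sub_dom i) =
  dchart i @` (D `&` (V `&` ddom i)) by rewrite -sub_image.
rewrite dopenE; split=> [oU|[V oV ->]].
  have exW i : exists W, open W /\
      sub_chart i @` (U `&` sub_dom i) = sub_chart i @` sub_dom i `&` W.
    by have [W ? ?] := oU i; exists W.
  pose W i := projT1 (cid (exW i)); have hW i := projT2 (cid (exW i)).
  rewrite -/(W _) in hW.
  exists [set x | exists2 V : set X, open V &
      V x /\ forall y : dsub, V (sub_val y) -> U y].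
    have -> : [set x : X | exists2 V : set X, open V &
        V x /\ forall y : dsub, V (sub_val y) -> U y] =
        \bigcup_(V in [set V : set X | open V /\ forall y : dsub, V (sub_val y) -> U y]) V.
      by apply/seteqP; split=> [x [V oV [Vx VU]]|x [V [oV VU] Vx]]; exists V.
    by apply: bigcup_open => V [].
  apply/seteqP; split=> [x Ux|x [V _ [Vx VU]]]; last exact: VU.
  have [i xi] := dcover (sub_val x).
  exists [set y | ddom i y /\ W i (dchart i y)]; first rewrite dopenE => j.
    have [V oV eV] := doverlap_open j i.
    have [g gE [_ _ /subspace_continuousP cg _]] := dtransition j i.
    exists (V `&` [set z | nbhs z [set w | (dchart j @` (@ddom X j `&` ddom i)) w ->
        W i (g w)]]).
      apply: openI => //; rewrite openE => z /= zW.
      by rewrite /interior; apply: filterS (nbhs_interior zW).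
    rewrite setIA -eV; apply/seteqP; split.
      move=> _ [y [[yi Wy] yj] <-]; split; first by exists y.
      apply: cg; first by exists y.
      rewrite /from_subspace gE //.
      by apply: open_nbhs_nbhs; split=> //; exact: (hW i).1.
    move=> _ [[y [yj yi] <-] /nbhs_singleton Wy]; exists y => //; split=> //.
    by split=> //; rewrite -gE //; apply: Wy; exists y.
  have h y : ddom i (sub_val y) -> W i (dchart i (sub_val y)) <-> U y.
    move=> yi; have e : (sub_chart i @` (U `&` sub_dom i)) (sub_chart i y) <-> U y.
      split=> [[z [Uz zi]]|Uy]; last by exists y.
      by move=> /(sub_chart_inj zi yi) <-.
    rewrite -e (hW i).2; split=> [?|[]//]; split=> //; by exists y.
  by split=> [|y [yi /h]]; [split=> //; exact/h|exact].
suff: forall i : dindex X, rel_open (sub_chart i @` sub_dom i)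
    (sub_chart i @` (sub_val @^-1` V `&` sub_dom i)) by [].
move=> i; rewrite dopenE in oV; have [W oW eW] := oV i; exists W => //.
rewrite imE (sub_image i (ddom i)); apply/seteqP; split.
  move=> _ [x [Dx [Vx xi]] <-]; split; first by exists x.
  by have : (dchart i @` ddom i `&` W) (dchart i x); [rewrite -eW; exists x|case].
move=> _ [[x [Dx xi] <-] Wx].
have : (dchart i @` (V `&` ddom i)) (dchart i x) by rewrite eW; split=> //; exists x.
by move=> [y [Vy yi] /(dchart_inj yi xi) yx]; subst y; exists x.
Qed.

End Subspace.

Section Product.
Variables X Y : defspace.

Definition prod_index : finType := (dindex X * dindex Y)%type.
Definition prod_dim (p : prod_index) : nat := (ddim p.1 + ddim p.2)%N.
Definition prod_dom (p : prod_index) : set (dcarrier X * dcarrier Y) :=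
  [set w | ddom p.1 w.1 /\ ddom p.2 w.2].
Definition prod_chart (p : prod_index) (w : dcarrier X * dcarrier Y) :
  'rV[M]_(prod_dim p) := row_mx (dchart p.1 w.1) (dchart p.2 w.2).

Lemma prod_image p (P : set X) (Q : set Y) :
  prod_chart p @` [set w | P w.1 /\ Q w.2] =
  rowprod (dchart p.1 @` P) (dchart p.2 @` Q).
Proof.
apply/seteqP; split=> [_ [[x y] [/= Px Qy] <-]|z [[x Px ex] [y Qy ey]]].
  by split; rewrite ?row_mxKl ?row_mxKr; [exists x|exists y].
by exists (x, y) => //; rewrite /prod_chart /= ex ey hsubmxK.
Qed.

Lemma prod_overlap p q : prod_dom p `&` prod_dom q =
  [set w | (@ddom X p.1 `&` ddom q.1) w.1 /\ (@ddom Y p.2 `&` ddom q.2) w.2].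
Proof. by apply/seteqP; split=> w [[? ?] [? ?]]. Qed.

Lemma prod_cover w : exists p, prod_dom p w.
Proof.
have [i xi] := dcover w.1; have [j yj] := dcover w.2.
by exists (i, j).
Qed.

Lemma prod_chart_inj p w w' : prod_dom p w -> prod_dom p w' ->
  prod_chart p w = prod_chart p w' -> w = w'.
Proof.
case: w w' => [x y] [x' y'] [/= xi yi] [/= xi' yi'] /eq_row_mx[].
by move=> /(dchart_inj xi xi') -> /(dchart_inj yi yi') ->.
Qed.

Lemma prod_def p : definable (prod_chart p @` prod_dom p).
Proof.
rewrite prod_image.
by apply: definable_rowprod; exact: ddef.
Qed.

Lemma prod_overlap_def p q : definable (prod_chart p @` (prod_dom p `&` prod_dom q)).
Proof.
rewrite prod_overlap prod_image.
by apply: definable_rowprod; exact: doverlap_def.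
Qed.

Lemma prod_overlap_open p q :
  rel_open (prod_chart p @` prod_dom p) (prod_chart p @` (prod_dom p `&` prod_dom q)).
Proof.
rewrite prod_overlap !prod_image.
by apply: rel_open_prod; exact: doverlap_open.
Qed.

Lemma prod_transition p q : exists2 g,
  (forall w, (prod_dom p `&` prod_dom q) w -> g (prod_chart p w) = prod_chart q w) &
  definable_homeo S (prod_chart p @` (prod_dom p `&` prod_dom q))
                    (prod_chart q @` (prod_dom p `&` prod_dom q)) g.
Proof.
have [g gE hg] := dtransition p.1 q.1; have [h hE hh] := dtransition p.2 q.2.
exists (fun z => row_mx (g (lsubmx z)) (h (rsubmx z))).
  move=> [x y]; rewrite prod_overlap => -[/gE + /hE].
  by rewrite /prod_chart row_mxKl row_mxKr /= => -> ->.
by rewrite prod_overlap !prod_image; exact: homeo_prod.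
Qed.

Definition dprod : defspace :=
  @DefSpace (dcarrier X * dcarrier Y)%type prod_index prod_dim prod_dom prod_chart
    prod_cover prod_chart_inj prod_def prod_overlap_def prod_overlap_open
    prod_transition.

End Product.

(* delta_j o f o theta_i^-1, as a graph *)
Definition map_graph (X Y : defspace) (f : X -> Y) i j : set 'rV[M]_(ddim i + ddim j) :=
  [set row_mx (dchart i x) (dchart j (f x)) | x in @ddom X i `&` f @^-1` @ddom Y j].
Arguments map_graph {X Y} f i j _.

Definition is_hom (X Y : defspace) (f : X -> Y) : Prop :=
  continuous f /\ forall i j, definable (map_graph f i j).

Record dhom (X Y : defspace) := DHom {
  hom_fun :> X -> Y;
  homP : is_hom hom_fun
}.

Lemma map_graphP (X Y : defspace) (f : X -> Y) i j u v :
  map_graph f i j (row_mx u v) <->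
  exists x, [/\ ddom i x, ddom j (f x), dchart i x = u & dchart j (f x) = v].
Proof.
split=> [[x [xi fj] /eq_row_mx [<- <-]]|[x [xi fj <- <-]]]; by exists x.
Qed.

Lemma range_definable (X Y : defspace) (f : dhom X Y) : is_definable (range f).
Proof.
move=> j; have H i := definable_exl ((homP f).2 i j).
apply: definable_ext (definable_bigU H) => v; split.
  by move=> [i _ [u /map_graphP[x [xi fj _ <-]]]]; exists (f x) => //; split.
move=> [_ [[x _ <-] fj] <-]; have [i xi] := dcover x.
by exists i => //; exists (dchart i x); apply/map_graphP; exists x.
Qed.

Lemma preimage_definable (X Y : defspace) (f : dhom X Y) (V : dset Y) :
  is_definable (f @^-1` V).
Proof.
move=> i.
have H j := definable_ex (definableI ((homP f).2 i j)
  (definable_pre (is_colsub_rsub (@is_colsub_id _ M _)) (dset_def V j))).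
apply: definable_ext (definable_bigU H) => u; split.
  move=> [j _ [v [/map_graphP[x [xi fj <- <-]]]]] /=; rewrite row_mxKr.
  move=> [y [Vy yj] /(dchart_inj yj fj) e]; exists x => //; split=> //.
  by rewrite /= -e.
move=> [x [Vx xi] <-]; have [j fj] := dcover (f x).
exists j => //; exists (dchart j (f x)); split; first by apply/map_graphP; exists x.
by rewrite /= row_mxKr; exists (f x).
Qed.

Lemma fiber_definable (X Y Z : defspace) (f : dhom X Z) (g : dhom Y Z) :
  is_definable ([set w | f w.1 = g w.2] : set (dprod X Y)).
Proof.
move=> [i j].
have L := is_colsub_lsub (@is_colsub_id _ M ((ddim i + ddim j) + _)).
have R := is_colsub_rsub (@is_colsub_id _ M ((ddim i + ddim j) + _)).
have H l := definable_ex (definableI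
  (definable_pre (is_colsub_row (is_colsub_lsub (L (ddim l))) (R (ddim l))) ((homP f).2 i l))
  (definable_pre (is_colsub_row (is_colsub_rsub (L (ddim l))) (R (ddim l))) ((homP g).2 j l))).
apply: definable_ext (definable_bigU H) => z; split.
  move=> [l _ [t []]] /=; rewrite !row_mxKl !row_mxKr.
  move=> /map_graphP[x [xi fl ex et]] /map_graphP[y [yj gl ey et']].
  exists (x, y); last by rewrite /= /prod_chart /= ex ey hsubmxK.
  by split=> //=; apply: (dchart_inj fl gl); rewrite et et'.
move=> [[x y] [/= fg [/= xi yj]] <-]; have [l fl] := dcover (f x).
exists l => //; exists (dchart l (f x)); rewrite /= !row_mxKl !row_mxKr.
by split; apply/map_graphP; [exists x|exists y]; rewrite -?fg.
Qed.

Definition range_dset (X Y : defspace) (f : dhom X Y) : dset Y :=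
  DSet (range_definable f).
Definition preim_dset (X Y : defspace) (f : dhom X Y) (V : dset Y) : dset X :=
  DSet (preimage_definable f V).
Definition fiber_prod (X Y Z : defspace) (f : dhom X Z) (g : dhom Y Z) : defspace :=
  dsub (DSet (fiber_definable f g)).

Definition corestrict (X Y : defspace) (f : dhom X Y) (x : X) : dsub (range_dset f) :=
  @sub_in Y (range_dset f) (f x) (ex_intro2 _ _ x I erefl).

Definition restrict_over (X Y : defspace) (f : dhom X Y) (V : dset Y)
    (x : dsub (preim_dset f V)) : dsub V :=
  sub_in (sub_valP x : dset_set V (f (sub_val x))).

(* <x, x'> |-> <f x, f' x'> from X x_Z X' to Y x_Z Y' *)
Definition fiber_map (X Y X' Y' Z : defspace)
    (p : dhom X Z) (q : dhom Y Z) (p' : dhom X' Z) (q' : dhom Y' Z)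
    (f : X -> Y) (f' : X' -> Y') (qf : q \o f =1 p) (qf' : q' \o f' =1 p')
    (w : fiber_prod p p') : fiber_prod q q' :=
  @sub_in (dprod Y Y') (DSet (fiber_definable q q'))
    (f (sub_val w).1, f' (sub_val w).2)
    (etrans (qf _) (etrans (sub_valP w) (esym (qf' _)))).

(* The limits at the left and right endpoints of an interval are taken along   *)
(* these filters, which makes sense for endpoints in M and for -oo, +oo.      *)
Definition left_end (I : interval M) : set_system M :=
  filter_from [set` I] (fun c => [set t | t \in I /\ (t < c)%O]).
Definition right_end (I : interval M) : set_system M :=
  filter_from [set` I] (fun c => [set t | t \in I /\ (c < t)%O]).

(* Only the values of alpha on the interval I matter. *)
Definition definable_curve (X : defspace) (C : set X) (I : interval M) (alpha : M -> X) :=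
  [/\ forall t, t \in I -> C (alpha t),
      {within [set` I], continuous alpha} &
      forall j, definable [set row_mx (const_mx t : 'rV[M]_1) (dchart j (alpha t)) |
                           t in [set` I] `&` alpha @^-1` @ddom X j]].

(* Limits are not assumed to be unique. *)
Definition completable (X : defspace) (C : set X) (I : interval M) (alpha : M -> X) :=
  (exists2 x, C x & alpha @ left_end I --> x) /\
  (exists2 x, C x & alpha @ right_end I --> x).

Definition definably_compact (X : defspace) (C : set X) : Prop :=
  forall (a b : itv_bound M) (alpha : M -> X),
    itv_open_ends (Interval a b) -> (a < b)%O ->
    definable_curve C (Interval a b) alpha -> completable C (Interval a b) alpha.

Definition definably_proper (X Y : defspace) (f : X -> Y) : Prop :=
  is_hom f /\
  forall K : dset Y, definably_compact K ->
    is_definable (f @^-1` K) /\ definably_compact (f @^-1` K).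

Definition homeomorphism (X Y : defspace) (f : X -> Y) : Prop :=
  continuous f /\ exists g : Y -> X, [/\ continuous g, cancel f g & cancel g f].

Definition closed_immersion (X Y : defspace) (f : dhom X Y) : Prop :=
  homeomorphism (corestrict f) /\ closed (range f).

Definition locally_closed (X : defspace) (A : set X) : Prop :=
  exists U F : set X, [/\ open U, closed F & A = U `&` F].

End DefinableSpaces.

Arguments restrict_over {d M S X Y} f V x.

(* Main.v *)
Require Import Defs.
From mathcomp Require Import all_boot all_order all_algebra.
From mathcomp Require Import boolp classical_sets functions set_interval filter topology.

(** A definably proper map lifts limits of definable curves: if the points of [Y] are
    closed, [alpha] is a curve in [X] and [f \o alpha] converges at one end of its
    interval, then so does [alpha] ([proper_lift]). The idea is to find a definably
    compact set [K] of [Y] with [alpha] running in the preimage of [K]; on a shorter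
    interval with the same end, [K] can be the image of [f \o alpha] together with its
    limits at the two ends ([arc_compact]). To see that such an arc is definably
    compact, let [gamma] be its parametrization. A curve [sigma] in the arc that avoids
    the two limits of [gamma] is of the form [gamma \o tau], where [tau s] is the least
    element of the fibre of [gamma] over [sigma s]; fibres are closed because points
    are. No choice is involved, so [tau] is definable, and although it may be
    discontinuous, o-minimality gives it a limit in the interval or at one of its ends,
    along which [gamma] converges.

    Arcs also show that in a space whose definably compact subsets are closed a
    curve has at most one limit ([curve_limit_unique]): the arc on a short
    interval is closed, so that a second limit would have to lie on it.

    These two facts reduce (4), the first half of (5) and the converse in (6) to
    following one curve [alpha] in the preimage of a definably compact [K]: its image
    has a limit in [K], a composite of [alpha] with a proper map therefore converges,
    hence so does [alpha], and its limit is mapped into [K] because limits are unique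
    or because [K] is closed. Statement (3) is the case of (4) where the second map
    is an identity, and (1) and (2) are direct.

    In the second half of (5) a curve in the range of [f] has to be lifted to [X].
    Skolem functions lift it pointwise, and the lift is continuous near the ends of
    the interval because every definable function of one variable is
    ([continuous_iend]). This rests on [uniform_right]: if a definable relation holds
    between each [x] and all [y] in a right neighbourhood of [x] that may depend on
    [x], then it holds between all [x < y] of some interval. Applied to the comparison
    of [f x] with [f y] for a definable [f], it shows that [f] is monotone on some
    interval, hence continuous on some interval; as this can be done inside any given
    interval, the points of discontinuity cannot accumulate at an end. *)

Set Implicit Arguments.
Unset Strict Implicit.
Unset Printing Implicit Defensive.

Import Order.TTheory.

Local Open Scope classical_set_scope.

(** * Definable predicates *)

Section Toolkit.
Variables (d : Order.disp_t) (M : orderTopologicalType d) (S : fo_structure M).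

(** Definability of a predicate written as a function, so that the closure
    lemmas can be applied by matching its body. *)
Definition dfn N (P : 'rV[M]_N -> Prop) : Prop := definable S [set z | P z].

(** The functions that may be substituted for the variables of a formula:
    coordinates and constants. *)
Definition dterm N (g : 'rV[M]_N -> M) : Prop :=
  (exists k, forall z, g z = z ord0 k) \/ (exists a, forall z, g z = a).

Definition dvec N n (f : 'rV[M]_N -> 'rV[M]_n) : Prop :=
  forall i, dterm (fun z => f z ord0 i).

Lemma dfn_ext N (P Q : 'rV[M]_N -> Prop) :
  (forall z, P z <-> Q z) -> dfn P -> dfn Q.
Proof. exact: definable_ext. Qed.

Lemma dfn_and N (P Q : 'rV[M]_N -> Prop) :
  dfn P -> dfn Q -> dfn (fun z => P z /\ Q z).
Proof. exact: definableI. Qed.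

Lemma dfn_or N (P Q : 'rV[M]_N -> Prop) :
  dfn P -> dfn Q -> dfn (fun z => P z \/ Q z).
Proof. exact: definableU. Qed.

Lemma dfn_not N (P : 'rV[M]_N -> Prop) : dfn P -> dfn (fun z => ~ P z).
Proof. by move=> [p hp]; exists (FNot p) => z /=; rewrite -hp. Qed.

Lemma dfn_imp N (P Q : 'rV[M]_N -> Prop) :
  dfn P -> dfn Q -> dfn (fun z => P z -> Q z).
Proof.
move=> dP dQ; apply: dfn_ext (dfn_or (dfn_not dP) dQ) => z.
by rewrite -implyE.
Qed.

Lemma dfn_exv N n (P : 'rV[M]_N -> 'rV[M]_n -> Prop) :
  dfn (fun z : 'rV[M]_(N + n) => P (lsubmx z) (rsubmx z)) ->
  dfn (fun z => exists u, P z u).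
Proof.
move=> /definable_ex; apply: definable_ext => z /=.
by split=> -[u Pu]; exists u; move: Pu; rewrite /= ?row_mxKl ?row_mxKr.
Qed.

Lemma dfn_ex N (P : 'rV[M]_N -> M -> Prop) :
  dfn (fun z : 'rV[M]_(N + 1) => P (lsubmx z) (rsubmx z ord0 ord0)) ->
  dfn (fun z => exists a, P z a).
Proof.
move=> h; apply: dfn_ext (dfn_exv (P := fun z u => P z (u ord0 ord0)) h) => z.
split=> [[u Pu]|[a Pa]]; first by exists (u ord0 ord0).
by exists (const_mx a); rewrite mxE.
Qed.

Lemma dfn_all N (P : 'rV[M]_N -> M -> Prop) :
  dfn (fun z : 'rV[M]_(N + 1) => P (lsubmx z) (rsubmx z ord0 ord0)) ->
  dfn (fun z => forall a, P z a).
Proof.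
move=> /dfn_not h.
have {h} := dfn_not (dfn_ex (P := fun z a => ~ P z a) h).
by apply: dfn_ext => z; rewrite -forallNE; split=> h a; have := h a; rewrite notK.
Qed.

Lemma dfn_prop N (P : Prop) : dfn (fun _ : 'rV[M]_N => P).
Proof.
have d0 : dfn (fun _ : 'rV[M]_N => False) := @definable0 _ M S N.
have [p|np] := pselect P; last by apply: dfn_ext d0 => z; split.
by apply: dfn_ext (dfn_not d0) => z; split=> // _ [].
Qed.

Lemma dfn_exfin N (I : finType) (P : I -> 'rV[M]_N -> Prop) :
  (forall i, dfn (P i)) -> dfn (fun z => exists i, P i z).
Proof.
move=> /(@definable_bigU _ M S N I); apply: definable_ext => z.
by split=> [[i _ Pi]|[i Pi]]; exists i.
Qed.

Lemma dfn_allfin N (I : finType) (P : I -> 'rV[M]_N -> Prop) :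
  (forall i, dfn (P i)) -> dfn (fun z => forall i, P i z).
Proof.
move=> h; have := dfn_not (dfn_exfin (fun i => dfn_not (h i))).
by apply: dfn_ext => z; rewrite -forallNE; split=> {}h i; have := h i; rewrite notK.
Qed.

Lemma dterm_fo N (g : 'rV[M]_N -> M) : dterm g ->
  exists t : term S N, forall z : 'rV[M]_N, Defs.eval (z ord0) t = g z.
Proof.
by move=> [[k gE]|[a gE]]; [exists (Tvar S k)|exists (Tpar S N a)] => z; rewrite gE.
Qed.

Lemma dfn_lt N (f g : 'rV[M]_N -> M) : dterm f -> dterm g ->
  dfn (fun z => (f z < g z)%O).
Proof.
move=> /dterm_fo[t tE] /dterm_fo[u uE]; exists (FLt t u) => z /=.
by rewrite tE uE.
Qed.

Lemma dfn_eq N (f g : 'rV[M]_N -> M) : dterm f -> dterm g ->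
  dfn (fun z => f z = g z).
Proof.
move=> /dterm_fo[t tE] /dterm_fo[u uE]; exists (FEq t u) => z /=.
by rewrite tE uE.
Qed.

Lemma dfn_le N (f g : 'rV[M]_N -> M) : dterm f -> dterm g ->
  dfn (fun z => (f z <= g z)%O).
Proof.
move=> df dg; apply: dfn_ext (dfn_not (dfn_lt dg df)) => z.
by rewrite leNgt; split=> /negP.
Qed.

Lemma dterm_cst N (a : M) : dterm (fun _ : 'rV[M]_N => a).
Proof. by right; exists a. Qed.

Lemma dvec_id N : dvec (fun z : 'rV[M]_N => z).
Proof. by move=> i; left; exists i. Qed.

Lemma dterm_coord N n (f : 'rV[M]_N -> 'rV[M]_n) i :
  dvec f -> dterm (fun z => f z ord0 i).
Proof. exact. Qed.

Lemma dterm_ext N (f g : 'rV[M]_N -> M) : f =1 g -> dterm f -> dterm g.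
Proof. by move=> /funext->. Qed.

Lemma dterm_comp N n (f : 'rV[M]_n -> M) (h : 'rV[M]_N -> 'rV[M]_n) :
  dterm f -> dvec h -> dterm (fun z => f (h z)).
Proof.
move=> [[k fE]|[a fE]] dh; last by right; exists a.
by apply: dterm_ext (dh k) => z; rewrite fE.
Qed.

Lemma dvec_comp N n m (f : 'rV[M]_n -> 'rV[M]_m) (h : 'rV[M]_N -> 'rV[M]_n) :
  dvec f -> dvec h -> dvec (fun z => f (h z)).
Proof. by move=> df dh i; exact: (dterm_comp (df i)). Qed.

Lemma dvec_lsub N n m (f : 'rV[M]_N -> 'rV[M]_(n + m)) :
  dvec f -> dvec (fun z => lsubmx (f z)).
Proof. by move=> df i; apply: dterm_ext (df (lshift m i)) => z; rewrite mxE. Qed.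

Lemma dvec_rsub N n m (f : 'rV[M]_N -> 'rV[M]_(n + m)) :
  dvec f -> dvec (fun z => rsubmx (f z)).
Proof. by move=> df i; apply: dterm_ext (df (rshift n i)) => z; rewrite mxE. Qed.

Lemma dvec_row N n m (f : 'rV[M]_N -> 'rV[M]_n) (g : 'rV[M]_N -> 'rV[M]_m) :
  dvec f -> dvec g -> dvec (fun z => row_mx (f z) (g z)).
Proof.
move=> df dg i; case: (split_ordP i) => j ->.
  by apply: dterm_ext (df j) => z; rewrite row_mxEl.
by apply: dterm_ext (dg j) => z; rewrite row_mxEr.
Qed.

Lemma dvec_const N n (f : 'rV[M]_N -> M) :
  dterm f -> dvec (fun z => const_mx (f z) : 'rV[M]_n).
Proof. by move=> df i; apply: dterm_ext df => z; rewrite mxE. Qed.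

(** Parameters may be substituted in a definable set, since a formula can say
    that an extra tuple of variables is equal to the substituted one. *)
Lemma dfn_mem N n (A : set 'rV[M]_n) (f : 'rV[M]_N -> 'rV[M]_n) :
  definable S A -> dvec f -> dfn (fun z => A (f z)).
Proof.
move=> dA df.
have : dfn (fun z => exists u, A u /\ forall i, u ord0 i = f z ord0 i).
  apply: dfn_exv; apply: dfn_and.
    exact: (definable_pre (is_colsub_rsub (@is_colsub_id _ _ _)) dA).
  apply: dfn_allfin => i; apply: dfn_eq.
    exact: (dvec_rsub (@dvec_id _)).
  apply: (dterm_comp (f := fun z => f z ord0 i)); first exact: df.
  exact: (dvec_lsub (@dvec_id _)).
apply: dfn_ext => z; split=> [[u [Au e]]|Af]; last by exists (f z).
by have <- : u = f z by apply/rowP.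
Qed.

(** Quantifying over all substituted terms makes these properties stable under the
    introduction of further variables by quantifiers. *)
Definition def1 (P : M -> Prop) : Prop :=
  forall N f, dterm f -> @dfn N (fun z => P (f z)).
Definition def2 (P : M -> M -> Prop) : Prop :=
  forall N f g, dterm f -> dterm g -> @dfn N (fun z => P (f z) (g z)).

Lemma def1P (P : M -> Prop) :
  def1 P <-> definable S [set z : 'rV[M]_1 | P (z ord0 ord0)].
Proof.
split=> [dP|dP N f df].
  by apply: dP; apply: dterm_coord; exact: dvec_id.
have := dfn_mem dP (dvec_const df).
by apply: dfn_ext => z /=; rewrite mxE.
Qed.

Lemma dfn_def1 N P (f : 'rV[M]_N -> M) :
  def1 P -> dterm f -> dfn (fun z => P (f z)).
Proof. exact. Qed.

Lemma dfn_def2 N P (f g : 'rV[M]_N -> M) :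
  def2 P -> dterm f -> dterm g -> dfn (fun z => P (f z) (g z)).
Proof. exact. Qed.

Definition deff (f : M -> M) : Prop := def2 (fun x y => f x = y).

Lemma dfn_deff N f (g h : 'rV[M]_N -> M) : deff f -> dterm g -> dterm h ->
  dfn (fun z => f (g z) = h z).
Proof. by move=> df; apply: df. Qed.

Lemma def2_l (P : M -> M -> Prop) a : def2 P -> def1 (P a).
Proof. by move=> dP N f df; apply: dP => //; exact: dterm_cst. Qed.

Lemma def2_r (P : M -> M -> Prop) a : def2 P -> def1 (P^~ a).
Proof. by move=> dP N f df; apply: dP => //; exact: dterm_cst. Qed.

Lemma def1_itv (I : interval M) : def1 (fun t => t \in I).
Proof.
case: I => a b N f df; apply: (@dfn_ext _ (fun z => (a <= BLeft (f z))%O /\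
    (BRight (f z) <= b)%O)).
  by move=> z; rewrite itv_boundlr; split=> /andP.
apply: dfn_and.
  case: a => [[] a|[]]; last first.
  - by apply: dfn_ext (dfn_prop N False) => z.
  - by apply: dfn_ext (dfn_prop N True) => z.
  - by apply: (dfn_lt (@dterm_cst _ a)).
  - by apply: (dfn_le (@dterm_cst _ a)).
case: b => [[] b|[]]; last first.
- by apply: dfn_ext (dfn_prop N True) => z.
- by apply: dfn_ext (dfn_prop N False) => z.
- by apply: (dfn_le _ (@dterm_cst _ b)).
- by apply: (dfn_lt _ (@dterm_cst _ b)).
Qed.

End Toolkit.

Ltac dterm_tac :=
  repeat first
    [ assumption
    | exact: dterm_cst | exact: dvec_id
    | apply: dterm_coord | apply: dvec_lsub | apply: dvec_rsub | apply: dvec_row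
    | apply: dvec_const
    | match goal with
      | h : dterm ?f |- dterm (fun z => ?f _) => apply: (dterm_comp h)
      | h : dvec ?f |- dvec (fun z => ?f _) => apply: (dvec_comp h)
      end ].

(* The branch for implications must precede the one for universal quantifiers,
   whose pattern they match as well. *)
Ltac dfn_step :=
  match goal with
  | |- def1 _ _ => let f := fresh "f" in let h := fresh "h" in move=> ? f h
  | |- def2 _ _ => let f := fresh "f" in let g := fresh "g" in
                 let h := fresh "h" in let k := fresh "k" in move=> ? f g h k
  | |- dfn _ (fun z => _ /\ _) => apply: dfn_and
  | |- dfn _ (fun z => _ \/ _) => apply: dfn_or
  | |- dfn _ (fun z => ~ _) => apply: dfn_not
  | |- dfn _ (fun z => exists a, _) => first [apply: dfn_ex | apply: dfn_exv]
  | |- dfn _ (fun z => _ -> _) => apply: dfn_imp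
  | |- dfn _ (fun z => forall a, _) => apply: dfn_all
  | |- dfn _ (fun z => is_true (_ < _)%O) => apply: dfn_lt; dterm_tac
  | |- dfn _ (fun z => is_true (_ <= _)%O) => apply: dfn_le; dterm_tac
  | h : deff _ ?f |- dfn _ (fun z => ?f _ = _) => apply: (dfn_deff h); dterm_tac
  | |- dfn _ (fun z => _ = _) => solve [apply: dfn_eq; dterm_tac]
  | h : def1 _ ?P |- dfn _ (fun z => ?P _) => apply: (dfn_def1 h); dterm_tac
  | h : def2 _ ?P |- dfn _ (fun z => ?P _ _) => apply: (dfn_def2 h); dterm_tac
  | |- dfn _ (fun z => is_true (_ \in _)) =>
      apply: (dfn_def1 (@def1_itv _ _ _ _)); dterm_tac
  | |- _ => solve [assumption | exact: dfn_prop]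
  end.
Ltac dfn_tac := repeat dfn_step.

(** * O-minimal orders *)

Section Line.
Variables (d : Order.disp_t) (M : orderTopologicalType d) (S : fo_structure M).
Hypothesis omin : o_minimal S.
Local Notation def1 := (def1 S).
Local Notation def2 := (def2 S).
Local Notation "x < y" := (x < y)%O.
Local Notation "x <= y" := (x <= y)%O.

Lemma omin_dense (x y : M) : x < y -> exists z, x < z /\ z < y.
Proof. by case: omin => _ h _ _ /h[z /andP[]]; exists z. Qed.

Lemma omin_nomin (x : M) : exists y, y < x.
Proof. by case: omin => _ _ h _; case: (h x). Qed.

Lemma omin_nomax (x : M) : exists y, x < y.
Proof. by case: omin => _ _ h _; case: (h x). Qed.

Lemma omin_repr (A : M -> Prop) : def1 A ->
  exists (P : seq M) (I : seq (interval M)), all itv_open_ends I /\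
    forall x, A x <-> x \in P \/ exists2 i, i \in I & x \in i.
Proof.
case: omin => _ _ _ h /def1P/h[P [I [oI ->]]]; exists P, I; split=> // x.
by split=> -[]; [left|right; exact/hasP|left|right; apply/hasP].
Qed.

Definition oitv (I : interval M) : Prop := itv_open_ends I /\ exists t, t \in I.

Lemma oitv_convex (I : interval M) x y z :
  x \in I -> y \in I -> x <= z -> z <= y -> z \in I.
Proof.
case: I => a b; rewrite !itv_boundlr => /andP[ax _] /andP[_ yb] xz zy.
apply/andP; split; first by apply: le_trans ax _; rewrite leBSide.
by apply: le_trans yb; rewrite leBSide.
Qed.

Lemma oitv_lt (I : interval M) x : itv_open_ends I -> x \in I ->
  exists y, y \in I /\ y < x.
Proof.
case: I => a b oI; rewrite itv_boundlr => /andP[ax xb].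
have h y : y < x -> (a <= BLeft y)%O -> y \in Interval a b /\ y < x.
  move=> yx ay; split=> //; rewrite itv_boundlr ay /=; apply: le_trans xb.
  by rewrite leBSide /= ltW.
case: a oI ax h => [s a|[]] oI ax h.
- rewrite (itv_open_ends_lside oI) in ax h *.
  have [y [ay yx]] := omin_dense ax.
  by exists y; apply: h.
- by have [y yx] := omin_nomin x; exists y; apply: h.
- by [].
Qed.

Lemma oitv_gt (I : interval M) x : itv_open_ends I -> x \in I ->
  exists y, y \in I /\ x < y.
Proof.
case: I => a b oI; rewrite itv_boundlr => /andP[ax xb].
have h y : x < y -> (BRight y <= b)%O -> y \in Interval a b /\ x < y.
  move=> yx ay; split=> //; rewrite itv_boundlr ay andbT; apply: le_trans ax _.
  by rewrite leBSide /= ltW.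
case: b oI xb h => [s b|[]] oI xb h.
- rewrite (itv_open_ends_rside oI) in xb h *.
  have [y [ay yx]] := omin_dense xb.
  by exists y; apply: h.
- by [].
- by have [y yx] := omin_nomax x; exists y; apply: h.
Qed.

Lemma oitv_oo (a b : M) : a < b -> oitv `]a, b[%O.
Proof.
move=> /omin_dense[z [az zb]]; split; first exact: orbT.
by exists z; rewrite in_itv /= az zb.
Qed.

Lemma omin_dich (A : M -> Prop) : def1 A ->
  (exists p q, p < q /\ forall x, p < x -> x < q -> A x) \/
  (exists s : seq M, forall x, A x -> x \in s).
Proof.
move=> /omin_repr[P [I [/allP oI AE]]].
have [[i iI [x xi]]|none] := pselect (exists2 i, i \in I & exists x, x \in i).
  left; have [p [pi px]] := oitv_lt (oI _ iI) xi.
  exists p, x; split=> // y py yx; apply/AE; right; exists i => //.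
  exact: oitv_convex pi xi (ltW py) (ltW yx).
right; exists P => x /AE[//|[i iI xi]]; case: none; exists i => //.
by exists x.
Qed.

(** A definable set is a finite union of points and intervals, and the sets that
    have a supremum as soon as they are non-empty and bounded above are closed
    under finite unions. *)
Lemma omin_sup (A : M -> Prop) u w : def1 A -> A u ->
  (forall x, A x -> x <= w) ->
  exists c, (forall x, A x -> x <= c) /\ forall y, y < c -> exists x, A x /\ y < x.
Proof.
pose hsup (A : M -> Prop) := forall u w, A u -> (forall x, A x -> x <= w) ->
  exists c, (forall x, A x -> x <= c) /\ forall y, y < c -> exists x, A x /\ y < x.
suff H : def1 A -> hsup A by move=> /H; apply.
have hU B C : hsup B -> hsup C -> hsup (fun x => B x \/ C x).
  move=> hB hC v z BCv vz.
  have [[b Bb]|nB] := pselect (exists b, B b); last first.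
    case: BCv => [Bv|Cv]; first by case: nB; exists v.
    have [c [cub club]] := hC v z Cv (fun x Cx => vz x (or_intror Cx)).
    exists c; split=> [x [Bx|/cub//]|y /club[x [Cx yx]]]; first by case: nB; exists x.
    by exists x; split=> //; right.
  have [b0 [bub blub]] := hB b z Bb (fun x Bx => vz x (or_introl Bx)).
  have [[c Cc]|nC] := pselect (exists c, C c); last first.
    exists b0; split=> [x [/bub//|Cx]|y /blub[x [Bx yx]]].
      by case: nC; exists x.
    by exists x; split=> //; left.
  have [c0 [cub club]] := hC c z Cc (fun x Cx => vz x (or_intror Cx)).
  exists (Order.max b0 c0); split=> [x [/bub|/cub]|y].
  - by rewrite le_max => ->.
  - by rewrite le_max orbC => ->.
  - rewrite lt_max => /orP[/blub|/club] [x [? yx]]; exists x; split=> //.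
      by left.
    by right.
have h0 : hsup (fun=> False) by move=> ? ? [].
have h1 p : hsup (fun x => x = p).
  by move=> _ _ _ _; exists p; split=> [x ->//|y yp]; exists p.
have hi i : itv_open_ends i -> hsup (fun x => x \in i).
  move=> oi v z vi ub; case: i oi vi ub => a b oi vi ub.
  have noub y : y \in Interval a b -> exists x, x \in Interval a b /\ y < x.
    exact: oitv_gt.
  case: b oi vi ub noub => [t b|t] oi vi ub noub; last first.
    have [x [xi zx]] : exists x, x \in Interval a (BInfty _ t) /\ z < x.
      apply: noub; move: vi (ub _ vi); rewrite !itv_boundlr => /andP[av vb] vz.
      apply/andP; split; first by apply: le_trans av _; rewrite leBSide.
      by move: vb; case: (t).
    by have := ub _ xi; rewrite leNgt zx.
  rewrite (itv_open_ends_rside oi) in vi ub noub *.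
  exists b; split=> [x|y yb]; first by rewrite itv_boundlr leBSide /= => /andP[_ /ltW].
  have [yv|vy] := ltP y v; first by exists v.
  apply: noub; move: vi; rewrite !itv_boundlr => /andP[av _]; apply/andP; split.
    by apply: le_trans av _; rewrite leBSide.
  by rewrite leBSide.
move=> /omin_repr[P [I [/allP oI AE]]].
have -> : A = (fun x => x \in P \/ exists2 i, i \in I & x \in i).
  by apply/funext => x; apply/propext.
apply: (hU).
  elim: P {AE} => [|p P IH]; first by move=> v z; rewrite in_nil.
  have -> : (fun x : M => x \in p :: P : Prop) = (fun x => x = p \/ x \in P).
    apply/funext => x; apply/propext; rewrite inE; split=> [/orP[/eqP|]|[/eqP|] ->].
    - by left.
    - by right.
    - by [].
    - by rewrite orbT.
  exact: (hU).
elim: I oI {AE} => [|i I IH] oI.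
  have -> : (fun x : M => exists2 i : interval M, i \in [::] & x \in i) = (fun=> False).
    by apply/funext => x; apply/propext; split=> // -[].
  exact: h0.
have -> : (fun x : M => exists2 j, j \in i :: I & x \in j) =
    (fun x => x \in i \/ exists2 j, j \in I & x \in j).
  apply/funext => x; apply/propext; split.
    by move=> [j]; rewrite inE => /predU1P[->|jI] xj; [left|right; exists j].
  by move=> [xi|[j jI xj]]; [exists i|exists j] => //; rewrite inE ?eqxx // jI orbT.
apply: (hU); first by apply: hi; apply: oI; rewrite inE eqxx.
by apply: IH => j jI; apply: oI; rewrite inE jI orbT.
Qed.

(** The left end for [true], the right end for [false]; most arguments below are
    the same at both ends. *)
Definition iend (e : bool) (I : interval M) : set_system M :=
  if e then left_end I else right_end I.

Lemma iend_filter e I : oitv I -> ProperFilter (iend e I).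
Proof.
move=> [oI [t tI]]; rewrite /iend; case: e.
  apply: filter_from_proper => [|x xI].
    apply: filter_from_filter => [|x y xI yI]; first by exists t.
    exists (Order.min x y); first by case: ltgtP xI yI.
    by move=> z /= [zI]; rewrite lt_min => /andP[].
  by have [y [yI yx]] := oitv_lt oI xI; exists y.
apply: filter_from_proper => [|x xI].
  apply: filter_from_filter => [|x y xI yI]; first by exists t.
  exists (Order.max x y); first by case: ltgtP xI yI.
  by move=> z /= [zI]; rewrite gt_max => /andP[].
by have [y [yI yx]] := oitv_gt oI xI; exists y.
Qed.

Lemma iend_itv e I : oitv I -> iend e I [set` I].
Proof. by move=> [oI [t tI]]; rewrite /iend; case: e; exists t => // x []. Qed.

(** The filter of an end is generated by initial or final segments, so
    membership in it can be expressed by a formula. *)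
Lemma def_iend e I (R : M -> M -> Prop) : def2 R ->
  def1 (fun m => iend e I (fun s => R s m)).
Proof.
move=> dR; case: e => N f df.
  apply: (@dfn_ext _ _ _ _ (fun z => exists c, c \in I /\
      forall s, s \in I /\ s < c -> R s (f z))).
    by move=> z; split=> [[c [cI h]]|[c cI h]]; exists c.
  by dfn_tac.
apply: (@dfn_ext _ _ _ _ (fun z => exists c, c \in I /\
    forall s, s \in I /\ c < s -> R s (f z))).
  by move=> z; split=> [[c [cI h]]|[c cI h]]; exists c.
by dfn_tac.
Qed.

(** An end decides rays and points, hence their Boolean combinations, and by
    o-minimality these are all the definable sets. *)
Lemma iend_dec e I (A : M -> Prop) : oitv I -> def1 A ->
  iend e I A \/ iend e I (fun t => ~ A t).
Proof.
move=> oI /omin_repr[P [J [_ AE]]].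
have := iend_filter e oI; set F := iend e I => FF.
pose dec B := F B \/ F (fun t : M => ~ B t).
have decC B : dec B -> dec (fun t => ~ B t).
  move=> [h|h]; [right|by left].
  by apply: filterS h => t Bt nBt.
have decI B C : dec B -> dec C -> dec (fun t => B t /\ C t).
  move=> [hB|hB] [hC|hC]; [left; exact: filterI|right..].
  - by apply: filterS hC => t nCt [].
  - by apply: filterS hB => t nBt [].
  - by apply: filterS hB => t nBt [].
have decU B C : dec B -> dec C -> dec (fun t => B t \/ C t).
  move=> hB hC; have := decC _ (decI _ _ (decC _ hB) (decC _ hC)).
  by congr dec; apply/funext => t; rewrite not_andE !not_notE.
have decE B C : (forall t, B t <-> C t) -> dec B -> dec C.
  move=> h; suff -> : B = C by [].
  by apply/funext => t; apply/propext/h.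
have dec0 : dec (fun=> False) by right; apply: filterS (iend_itv e oI) => t _ [].
have decT : dec (fun=> True) by left; apply: filterS (iend_itv e oI) => t _.
have declt p : dec (fun t => t < p).
  have [pI|pI] := boolP (p \in I).
    rewrite /dec /F /iend; case: (e); [left|right].
      by exists p => // t [].
    by exists p => // t [_ pt] /=; apply/negP; rewrite -leNgt ltW.
  case: (oI) => _ [u uI]; have [up|pu] := ltP u p.
    left; apply: filterS (iend_itv e oI) => t /= tI.
    rewrite ltNge; apply: contra pI => pt.
    exact: oitv_convex uI tI (ltW up) pt.
  right; apply: filterS (iend_itv e oI) => t /= tI.
  apply/negP; apply: contraNN pI => tp.
  exact: oitv_convex tI uI (ltW tp) pu.
have decgt p : dec (fun t => p < t).
  have [pI|pI] := boolP (p \in I).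
    rewrite /dec /F /iend; case: (e); [right|left].
      by exists p => // t [_ pt] /=; apply/negP; rewrite -leNgt ltW.
    by exists p => // t [].
  case: (oI) => _ [u uI]; have [up|pu] := ltP u p.
    right; apply: filterS (iend_itv e oI) => t /= tI.
    apply/negP; apply: contraNN pI => tp.
    exact: oitv_convex uI tI (ltW up) (ltW tp).
  left; apply: filterS (iend_itv e oI) => t /= tI.
  rewrite ltNge; apply: contra pI => tp.
  exact: oitv_convex tI uI tp pu.
have decP p : dec (fun t => t = p).
  apply: (decE) (decI _ _ (decC _ (declt p)) (decC _ (decgt p))) => t.
  split=> [[/negP h /negP k]|->]; last by rewrite ltxx.
  by apply/eqP; rewrite eq_le !leNgt h k.
have decJ (i : interval M) : dec (fun t => t \in i).
  case: i => a b; apply: (decE) (decI (fun t => a <= BLeft t) (fun t => BRight t <= b) _ _).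
  - by move=> t; rewrite itv_boundlr; split=> /andP.
  - case: a => [[] p|[]].
    + apply: (decE) (decC _ (declt p)) => t; rewrite leBSide /= leNgt.
      by split=> /negP.
    + by apply: (decE) (decgt p) => t; rewrite leBSide.
    + by apply: (decE) decT => t.
    + by apply: (decE) dec0 => t.
  - case: b => [[] p|[]].
    + by apply: (decE) (declt p) => t; rewrite leBSide.
    + apply: (decE) (decC _ (decgt p)) => t; rewrite leBSide /= leNgt.
      by split=> /negP.
    + by apply: (decE) dec0 => t.
    + by apply: (decE) decT => t.
apply: (decE) (fun t => iff_sym (AE t)) _; apply: (decU).
  elim: P {AE} => [|p P IH]; first by apply: (decE) dec0 => t.
  apply: (decE) (decU _ _ (decP p) IH) => t; rewrite inE.
  by split=> [[->|->]|/predU1P]; rewrite ?eqxx ?orbT.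
elim: J {AE} => [|i J IH]; first by apply: (decE) dec0 => t; split=> // -[].
apply: (decE) (decU _ _ (decJ i) IH) => t; split.
  by move=> [xi|[j jI xj]]; [exists i|exists j] => //; rewrite inE ?eqxx // jI orbT.
by move=> [j]; rewrite inE => /predU1P[->|jI] xj; [left|right; exists j].
Qed.

(** Dedekind cuts given by a definable initial segment are filled. *)
Lemma omin_cut (U : M -> Prop) u w : def1 U -> U u -> ~ U w ->
  (forall x y, x < y -> U y -> U x) ->
  exists c, [/\ u <= c, c <= w, forall m, m < c -> U m & forall m, c < m -> ~ U m].
Proof.
move=> dU Uu nUw down; have Uw x : U x -> x <= w.
  by move=> Ux; rewrite leNgt; apply/negP => /down/(_ Ux).
have [c [cub club]] := omin_sup dU Uu Uw; exists c; split.
- exact: cub.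
- by rewrite leNgt; apply/negP => /club[x [/Uw xw]]; rewrite ltNge xw.
- by move=> m /club[x [Ux /down]]; apply.
- by move=> m cm /cub; rewrite leNgt cm.
Qed.

Lemma nbhs_oo (x : M) (P : set M) :
  nbhs x P <-> exists p q, [/\ p < x, x < q & forall y, p < y -> y < q -> P y].
Proof.
rewrite itv_nbhsE; split=> [[i [oi xi] iP]|[p [q [px xq h]]]].
  have [p [pi px]] := oitv_lt oi xi; have [q [qi xq]] := oitv_gt oi xi.
  exists p, q; split=> // y py yq; apply: iP.
  exact: oitv_convex pi qi (ltW py) (ltW yq).
exists `]p, q[%O; first by split; rewrite ?in_itv /= ?px //; exact: orbT.
by move=> y /=; rewrite in_itv /= => /andP[]; exact: h.
Qed.

(** Near an end every set of its filter contains a whole interval. The other end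
    [c] of that interval is a point of [I], where a curve on [I] is continuous;
    curves on the smaller interval thus converge there as soon as they extend
    to [I]. *)
Lemma iend_shrink e I (A : set M) : oitv I -> iend e I A ->
  exists J c, [/\ oitv J, A c /\ c \in I,
    forall t, t \in J -> t \in I /\ A t,
    forall B : set M, iend e I B <-> iend e J B & nbhs c `<=` iend (~~ e) J].
Proof.
move=> [oI _]; case: e => -[x xI xA].
  have [c [cI cx]] := oitv_lt oI xI; have [y [yI yc]] := oitv_lt oI cI.
  have [a [b eI]] : exists a b, I = Interval a b by case: (I) => a b; exists a, b.
  subst I; pose J := Interval a (BLeft c).
  have JE t : t \in J <-> t \in Interval a b /\ t < c.
    move: (cI); rewrite !itv_boundlr => /andP[ac cb]; split.
      move=> /andP[-> tc]; rewrite leBSide in tc; split=> //=.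
      by apply: le_trans cb; rewrite leBSide /= ltW.
    by move=> [/andP[-> _] tc]; rewrite leBSide.
  exists J, c; split.
  - split; last by exists y; apply/JE.
    by move: oI; rewrite /J; case: (a) => [[]t|[]]; case: (b) => [[]s|[]].
  - by split=> //; apply: xA.
  - move=> t /JE[tI tc]; split=> //; apply: xA; split=> //; exact: lt_trans cx.
  - move=> B; split=> -[z zI zB].
      exists (Order.min y z).
        by apply/JE; rewrite gt_min yc /=; split=> //; case: ltgtP yI zI.
      by move=> t /= [/JE[tI _]]; rewrite lt_min => /andP[_ tz]; apply: zB.
    move/JE: zI => [zI zc]; exists z => // t [tI tz]; apply: zB; split=> //.
    by apply/JE; split=> //; exact: lt_trans zc.
  - move=> B /nbhs_oo[p [q [pc cq h]]].
    exists (Order.max p y).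
      apply/JE; rewrite gt_max yc pc; split=> //.
      case: (ltP p y) => // py.
      exact: oitv_convex yI cI py (ltW pc).
    move=> t [/JE[_ tc]]; rewrite gt_max => /andP[pt _]; apply: h => //.
    exact: lt_trans cq.
have [c [cI cx]] := oitv_gt oI xI; have [y [yI yc]] := oitv_gt oI cI.
have [a [b eI]] : exists a b, I = Interval a b by case: (I) => a b; exists a, b.
subst I; pose J := Interval (BRight c) b.
have JE t : t \in J <-> t \in Interval a b /\ c < t.
  move: (cI); rewrite !itv_boundlr => /andP[ac cb]; split.
    move=> /andP[tc ->]; rewrite leBSide in tc; split=> //=.
    by rewrite andbT; apply: le_trans ac _; rewrite leBSide /= ltW.
  by move=> [/andP[_ ->] tc]; rewrite leBSide /= tc.
exists J, c; split.
- split; last by exists y; apply/JE.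
  by move: oI; rewrite /J; case: (a) => [[]t|[]]; case: (b) => [[]s|[]].
- by split=> //; apply: xA.
- move=> t /JE[tI tc]; split=> //; apply: xA; split=> //; exact: lt_trans tc.
- move=> B; split=> -[z zI zB].
    exists (Order.max y z).
      by apply/JE; rewrite lt_max yc /=; split=> //; case: ltgtP yI zI.
    by move=> t /= [/JE[tI _]]; rewrite gt_max => /andP[_ tz]; apply: zB.
  move/JE: zI => [zI zc]; exists z => // t [tI tz]; apply: zB; split=> //.
  by apply/JE; split=> //; exact: lt_trans tz.
- move=> B /nbhs_oo[p [q [pc cq h]]].
  exists (Order.min y q).
    apply/JE; rewrite lt_min yc cq; split=> //.
    case: (ltP y q) => // qy.
    exact: oitv_convex cI yI (ltW cq) qy.
  move=> t [/JE[_ tc]]; rewrite lt_min => /andP[_ pt]; apply: h => //.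
  exact: lt_trans tc.
Qed.

End Line.

(** * Definable functions of one variable *)

Section Monotone.
Variables (d : Order.disp_t) (M : orderTopologicalType d) (S : fo_structure M).
Hypothesis omin : o_minimal S.
Local Notation def1 := (def1 S).
Local Notation def2 := (def2 S).
Local Notation deff := (deff S).
Local Notation "x < y" := (x < y)%O.
Local Notation "x <= y" := (x <= y)%O.

Lemma omin_dense2 (a b c : M) : a < b -> a < c -> exists x, [/\ a < x, x < b & x < c].
Proof.
move=> ab ac; have [|x [ax]] := @omin_dense _ _ _ omin a (Order.min b c).
  by rewrite lt_min ab.
by rewrite lt_min => /andP[xb xc]; exists x.
Qed.

Lemma fin_max (P : M -> Prop) (s : seq M) : (exists x, P x) ->
  (forall x, P x -> x \in s) -> exists x, P x /\ forall y, P y -> y <= x.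
Proof.
elim: s P => [|a s IH] P exP Ps; first by case: exP => x /Ps.
have [[x [Px xa]]|no] := pselect (exists x, P x /\ a < x).
  have [||y [[Py ay] ymax]] := IH (fun x => P x /\ a < x).
  - by exists x.
  - by move=> y [/Ps]; rewrite inE => /predU1P[->|//]; rewrite ltxx.
  exists y; split=> // z Pz; have [za|az] := leP z a; last exact: ymax.
  exact: le_trans za (ltW ay).
have Pa x : P x -> x <= a.
  by move=> Px; rewrite leNgt; apply/negP => ax; apply: no; exists x.
have [Pa'|nPa] := pselect (P a); first by exists a.
apply: IH => // x Px; have := Ps _ Px; rewrite inE => /predU1P[xa|//].
by rewrite xa in Px.
Qed.

(** A functional relation takes finitely many values on a finite set, so those
    above [a] stay away from [a]. *)
Lemma fin_low (T : eqType) (P : T -> M -> Prop) (s : seq T) (a : M) :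
  (forall z x y, P z x -> P z y -> x = y) ->
  exists m, a < m /\ forall z x, z \in s -> P z x -> a < x -> m <= x.
Proof.
move=> Pfun; elim: s => [|z s [m [am h]]].
  by have [m am] := omin_nomax omin a; exists m; split.
have [[x [Pzx ax]]|no] := pselect (exists x, P z x /\ a < x); last first.
  exists m; split=> // y x; rewrite inE => /predU1P[->|ys] Px ax; last exact: h ys Px ax.
  by case: no; exists x.
exists (Order.min m x); split; first by rewrite lt_min am.
move=> y w; rewrite inE => /predU1P[->|ys] Pw aw.
  by rewrite (Pfun _ _ _ Pw Pzx) ge_min lexx orbT.
by rewrite ge_min (h _ _ ys Pw aw).
Qed.

Lemma itv_inj_infinite (T : eqType) (f : M -> T) p q (s : seq T) : p < q ->
  (forall x y, p < x -> x < q -> p < y -> y < q -> f x = f y -> x = y) ->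
  exists x, [/\ p < x, x < q & f x \notin s].
Proof.
move=> pq inj; pose P z x := [/\ p < x, x < q & f x = z].
have [|m [pm h]] := @fin_low _ P s p.
  by move=> z x y [px xq <-] [py yq /esym]; apply: inj.
have [x [px xm xq]] := omin_dense2 pm pq; exists x; split=> //; apply/negP => fs.
by have := h _ x fs (And3 px xq erefl) px; rewrite leNgt xm.
Qed.

Definition right_near (x : M) (P : M -> Prop) : Prop :=
  exists c, x < c /\ forall y, x < y -> y < c -> P y.

Lemma right_dec x (P : M -> Prop) : def1 P ->
  right_near x P \/ right_near x (fun y => ~ P y).
Proof.
have [z xz] := omin_nomax omin x.
have oI : oitv `]x, z[%O by exact: (oitv_oo omin).
have H (B : M -> Prop) : iend true `]x, z[%O B -> right_near x B.
  move=> [c /=]; rewrite in_itv /= => /andP[xc cz] h; exists c; split=> // y xy yc.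
  by apply: h; split=> //; rewrite in_itv /= xy (lt_trans yc).
by move=> /(iend_dec omin true oI)[/H|/H]; [left|right].
Qed.

(** Suppose that no interval has this property, and say that [x] reaches [z] if
    [R x y] for all [y] in ]x, z] ([G x z] below). The points that reach a given [z]
    contain no interval, so they are finitely many; let m(z) be the largest.
    Each [x] reaches all points [z] close enough on its right, and then m(z) >= x.
    - A point [b] satisfies m(z) <= b < z for finitely many [z] only ([Pfin]): on an
      interval of such [z], any element [x] of that interval would give m(z) >= x > b
      for [z] close to [x] on the right.
    - The intervals ]m(z), z[ are nested or disjoint ([m_cross]).
    - Fix [d0]. For [z] in some ]d0, e0[, m(z) > d0; the intervals ]m(z), z[ for
      these [z] cover a definable set with points arbitrarily close to [d0], hence
      they cover some ]d0, e1[.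
    For [c] in ]d0, e1[ let ]m(z), z[ be the outermost of these intervals around
    [c]. If z < e1, then [z] itself is covered by some ]m(z'), z'[, which by
    nestedness is a larger interval around [c], a contradiction; so z >= e1. Fix [f1]
    in ]d0, e1[. For [c < f1] the outermost interval contains [f1], so there are
    finitely many of them, and their left ends are bounded away from [d0]. This is
    absurd, since m(z) < c and [c] is arbitrarily close to [d0]. *)
Lemma uniform_right (R : M -> M -> Prop) p0 q0 : def2 R -> p0 < q0 ->
  (forall x, p0 < x -> x < q0 -> right_near x (R x)) ->
  exists p q, [/\ p < q, forall x, p < x -> x < q -> p0 < x /\ x < q0 &
    forall x y, p < x -> x < y -> y < q -> R x y].
Proof.
move=> dR pq0 near; apply: contrapT => noJ.
pose G x z := [/\ p0 < x, x < z, z < q0 & forall y, x < y -> y <= z -> R x y].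
have dG : def2 G.
  move=> N f g df dg; apply: (@dfn_ext _ _ _ _ (fun z => p0 < f z /\ (f z < g z /\
    (g z < q0 /\ forall y, f z < y -> y <= g z -> R (f z) y)))).
    by move=> z; split=> [[?[?[? ?]]]|[]].
  by dfn_tac.
have Gdown x z z' : G x z -> x < z' -> z' <= z -> G x z'.
  move=> [px xz zq h] xz' z'z; split=> //; first exact: le_lt_trans zq.
  by move=> y xy yz'; apply: h => //; exact: le_trans z'z.
have Gnear x : p0 < x -> x < q0 ->
    exists c, [/\ x < c, c <= q0 & forall z, x < z -> z < c -> G x z].
  move=> px xq; have [c [xc h]] := near _ px xq; exists (Order.min c q0); split.
  - by rewrite lt_min xc.
  - by rewrite ge_min lexx orbT.
  move=> z xz; rewrite lt_min => /andP[zc zq]; split=> // y xy yz.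
  by apply: h => //; exact: le_lt_trans zc.
have Gfin z : exists s : seq M, forall x, G x z -> x \in s.
  have [[p [q [pq h]]]|//] := omin_dich omin (def2_r z dG); case: noJ.
  exists p, q; split=> // [x px xq|x y px xy yq].
    by have [? xz zq _] := h x px xq; split=> //; exact: lt_trans zq.
  have [_ xz _ hR] := h x px (lt_trans xy yq).
  have [_ yz _ _] := h y (lt_trans px xy) yq.
  by apply: hR => //; exact: ltW.
pose m x z := G x z /\ forall x', G x' z -> x' <= x.
have dm : def2 m by move=> N f g df dg; rewrite /m; dfn_tac.
have m_ex x z : G x z -> exists x', m x' z /\ x <= x'.
  move=> Gxz; have [s hs] := Gfin z.
  have [x' [Gx' max]] := fin_max (ex_intro _ x Gxz) hs.
  by exists x'; split; [|exact: max].
have m_fun z x y : m x z -> m y z -> x = y.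
  by move=> [Gx mx] [Gy my]; apply/eqP; rewrite eq_le mx ?my.
have m_cross x z x' z' : m x z -> m x' z' -> z < z' -> x' < z -> x' <= x.
  by move=> [_ mx] [Gx' _] zz' x'z; apply: mx; apply: Gdown Gx' _ (ltW zz').
have Pfin b : exists s : seq M, forall z, b < z ->
    (exists x, m x z /\ x <= b) -> z \in s.
  have dP : def1 (fun z => b < z /\ exists x, m x z /\ x <= b) by dfn_tac.
  have [[p [q [pq h]]]|[s hs]] := omin_dich omin dP; last first.
    by exists s => z bz ex; apply: hs.
  have [x [px xq]] := omin_dense omin pq.
  have [bx [w [[[pw wx xq0 _] _] wb]]] := h x px xq.
  have [c [xc _ Gx]] := Gnear x (lt_trans pw wx) xq0.
  have [z [xz zc zq]] := omin_dense2 xc xq.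
  have [_ [w' [mw' w'b]]] := h z (lt_trans px xz) zq.
  have := mw'.2 _ (Gx z xz zc); move=> /le_trans/(_ w'b).
  by rewrite leNgt bx.
have [d0 [pd dq]] := omin_dense omin pq0.
have [e0 [de eq0 he0]] : exists e0, [/\ d0 < e0, e0 <= q0 &
    forall z, d0 < z -> z < e0 -> exists x, m x z /\ d0 < x].
  have [c [dc cq Gd]] := Gnear _ pd dq; have [s hs] := Pfin d0.
  have [|e [d0e he]] := @fin_low _ (fun z x : M => z = x) s d0.
    by move=> z x y <-.
  exists (Order.min c e); split; first by rewrite lt_min dc.
    by rewrite ge_min cq.
  move=> z dz; rewrite lt_min => /andP[zc ze].
  have [x [mx _]] := m_ex _ _ (Gd z dz zc); exists x; split=> //.
  rewrite ltNge; apply/negP => xd.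
  have zs : z \in s by apply: hs => //; exists x.
  by have := he z z zs erefl dz; rewrite leNgt ze.
pose Q c z := [/\ c < z, z < e0 & exists x, [/\ d0 < x, x < c & m x z]].
have dQ : def1 (fun c => exists z, Q c z).
  move=> N f df; apply: (@dfn_ext _ _ _ _ (fun v => exists z, f v < z /\ (z < e0 /\
    exists x, d0 < x /\ (x < f v /\ m x z)))).
    move=> v; split=> [[z [? [? [x [? [? ?]]]]]]|[z [? ? [x [? ? ?]]]]]; exists z.
      by split=> //; exists x.
    by do 2 split=> //; exists x.
  by dfn_tac.
have [e1 [de1 e1e0 he1]] : exists e1, [/\ d0 < e1, e1 <= e0 &
    forall c, d0 < c -> c < e1 -> exists z, Q c z].
  have [[e [d0e he]]|[e [d0e he]]] := right_dec d0 dQ.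
    exists (Order.min e e0); split; first by rewrite lt_min d0e.
      by rewrite ge_min lexx orbT.
    by move=> c dc; rewrite lt_min => /andP[ce _]; apply: he.
  have [z [dz ze ze0]] := omin_dense2 d0e de; have [x [mx dx]] := he0 z dz ze0.
  have [_ xz _ _] := mx.1; have [c [xc cz]] := omin_dense omin xz.
  case: (he c (lt_trans dx xc) (lt_trans cz ze)); exists z; split=> //; by exists x.
have [f1 [df1 fe1]] := omin_dense omin de1.
have [s hs] := Pfin f1.
have [|u [du hu]] := @fin_low _ (fun z x => m x z) s d0; first exact: m_fun.
have [c [dc cu cf]] := omin_dense2 du df1.
have [z [[cz ze [x [dx xc mx]]] zmax]] :
    exists z, Q c z /\ forall z', Q c z' -> z' <= z.
  have [t ht] := Pfin c; apply: (@fin_max _ t).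
    by apply: he1 => //; exact: lt_trans fe1.
  by move=> z [cz _ [x [_ xc mx]]]; apply: ht => //; exists x; split=> //; exact: ltW.
have e1z : e1 <= z.
  rewrite leNgt; apply/negP => ze1.
  have [z' [zz' z'e [x' [dx' x'z mx']]]] := he1 z (lt_trans dc cz) ze1.
  have x'x := m_cross _ _ _ _ mx mx' zz' x'z.
  suff /zmax : Q c z' by rewrite leNgt zz'.
  by split=> //; [exact: lt_trans zz'|exists x'; split=> //; exact: le_lt_trans xc].
have fz : f1 < z by exact: lt_le_trans e1z.
have zs : z \in s.
  by apply: hs => //; exists x; split=> //; apply: ltW; exact: lt_trans cf.
by have := hu z x zs mx dx; rewrite leNgt (lt_trans xc cu).
Qed.

Lemma deff_lt f : deff f -> def2 (fun x y => f x < f y).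
Proof.
move=> df N g h dg dh; apply: (@dfn_ext _ _ _ _ (fun z => exists u, exists v,
  f (g z) = u /\ (f (h z) = v /\ u < v))).
  by move=> z; split=> [[u [v [-> [->]]]]|]; [|exists (f (g z)), (f (h z))].
by dfn_tac.
Qed.

Lemma deff_eq f : deff f -> def2 (fun x y => f x = f y).
Proof.
move=> df N g h dg dh; apply: (@dfn_ext _ _ _ _ (fun z => exists u,
  f (g z) = u /\ f (h z) = u)).
  by move=> z; split=> [[u [-> ->]]|->]; [|exists (f (h z))].
by dfn_tac.
Qed.

(** Each [x] satisfies one of [f x = f y], [f x < f y], [f y < f x] for all [y] close
    enough on its right, so one of these cases occurs on an infinite set of [x],
    which contains an interval; there [uniform_right] applies. *)
Lemma monotone_somewhere f p0 q0 : deff f -> p0 < q0 ->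
  exists p q, [/\ p < q, forall x, p < x -> x < q -> p0 < x /\ x < q0 &
    [\/ forall x y, p < x -> x < y -> y < q -> f x = f y,
        forall x y, p < x -> x < y -> y < q -> f x < f y |
        forall x y, p < x -> x < y -> y < q -> f y < f x]].
Proof.
move=> df pq0.
have d1 := deff_eq df; have d2 := deff_lt df.
have d3 : def2 (fun x y => f y < f x) by move=> N g h dg dh; apply: d2.
have dnear (R : M -> M -> Prop) : def2 R ->
    def1 (fun x => (p0 < x /\ x < q0) /\ right_near x (R x)).
  by move=> dR; rewrite /right_near; dfn_tac.
have step (R : M -> M -> Prop) : def2 R ->
    (exists p q, [/\ p < q, forall x, p < x -> x < q -> p0 < x /\ x < q0 &
      forall x y, p < x -> x < y -> y < q -> R x y]) \/
    exists s : seq M, forall x, p0 < x -> x < q0 -> right_near x (R x) -> x \in s.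
  move=> dR; have [[p [q [pq h]]]|[s hs]] := omin_dich omin (dnear R dR); last first.
    by right; exists s => x px xq nx; apply: hs.
  have [|p' [q' [pq' sub hR]]] := uniform_right dR pq.
    by move=> x px xq; have [] := h x px xq.
  left; exists p', q'; split=> // x px xq; have [px' xq'] := sub x px xq.
  by have [[]] := h x px' xq'.
have [[p [q [? ? h]]]|[s1 hs1]] := step _ d1.
  by exists p, q; split=> //; apply: Or31.
have [[p [q [? ? h]]]|[s2 hs2]] := step _ d2.
  by exists p, q; split=> //; apply: Or32.
have [[p [q [? ? h]]]|[s3 hs3]] := step _ d3.
  by exists p, q; split=> //; apply: Or33.
have [//|x [px xq]] := @itv_inj_infinite _ id p0 q0 (s1 ++ s2 ++ s3) pq0.
rewrite !mem_cat => /negP[].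
have [n1|n1] := right_dec x (def2_l x d1); first by rewrite hs1.
have [n2|n2] := right_dec x (def2_l x d2); first by rewrite hs2 // orbT.
rewrite hs3 ?orbT //.
have [[c1 [xc1 h1]] [c2 [xc2 h2]]] := (n1, n2).
exists (Order.min c1 c2); split; first by rewrite lt_min xc1.
move=> y xy; rewrite lt_min => /andP[y1 y2].
by have := h1 y xy y1; have := h2 y xy y2; case: ltgtP.
Qed.

(** Continuity at a point as a first-order condition; bounded intervals suffice
    because [M] has no endpoints. *)
Definition cont_at (f : M -> M) (x : M) : Prop :=
  forall l h, l < f x -> f x < h ->
  exists a b, [/\ a < x, x < b & forall y, a < y -> y < b -> l < f y /\ f y < h].

Lemma def_cont_at f : deff f -> def1 (cont_at f).
Proof.
move=> df N g dg.
apply: (@dfn_ext _ _ _ _ (fun z => forall l, forall h,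
  (exists u, f (g z) = u /\ (l < u /\ u < h)) ->
  exists a, exists b, a < g z /\ (g z < b /\ forall y, a < y -> y < b ->
    (exists u, f y = u /\ (l < u /\ u < h))))).
  move=> z; split=> h l u.
    move=> lf fu; have [|a [b [agz [gzb hab]]]] := h l u; first by exists (f (g z)).
    by exists a, b; split=> // y ay yb; have [w [<-]] := hab y ay yb.
  move=> [w [<- [lf fu]]]; have [a [b [agz gzb hab]]] := h l u lf fu.
  by exists a, b; do 2 split=> //; move=> y ay yb; exists (f y); split=> //; apply: hab.
by dfn_tac.
Qed.

Lemma cont_atP f x : cont_at f x -> f @ nbhs x --> f x.
Proof.
move=> fx A /(nbhs_oo omin)[l [h [lf fh hA]]].
have [a [b [ax xb hab]]] := fx l h lf fh.
apply/(nbhs_oo omin); exists a, b; split=> // y ay yb.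
by have [] := hab y ay yb; exact: hA.
Qed.

(** A strictly monotone definable function has an infinite image, which contains
    an interval; on the preimage of that interval the function is an order
    isomorphism onto an interval, up to reversal of the order. *)
Lemma continuous_somewhere f p0 q0 : deff f -> p0 < q0 ->
  exists p q, [/\ p < q, forall x, p < x -> x < q -> p0 < x /\ x < q0 &
    forall x, p < x -> x < q -> cont_at f x].
Proof.
move=> df pq0; have [p [q [pq sub hm]]] := monotone_somewhere df pq0.
have [cst|[e hme]] : (forall x y, p < x -> x < y -> y < q -> f x = f y) \/
   exists e : bool, forall x y, p < x -> x < q -> p < y -> y < q ->
     (f x < f y) = (if e then x < y else y < x).
  case: hm => h; [by left|right; exists true => x y px xq py yq|].
    case: (ltgtP x y) => [xy|yx|->]; [exact: h| |exact: ltxx].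
    by apply/negbTE; rewrite -leNgt ltW // h.
  right; exists false => x y px xq py yq.
  case: (ltgtP x y) => [xy|yx|->]; [|exact: h|exact: ltxx].
  by apply/negbTE; rewrite -leNgt ltW // h.
  exists p, q; split=> // x px xq l h lf fh; exists p, q; split=> // y py yq.
  by have [xy|yx|<-//] := ltgtP x y; [rewrite -(cst x y)|rewrite (cst y x)].
have inj x y : p < x -> x < q -> p < y -> y < q -> f x = f y -> x = y.
  move=> px xq py yq exy; have := hme x y px xq py yq; have := hme y x py yq px xq.
  by rewrite exy ltxx; case: (e); case: ltgtP.
pose im y := exists x, (p < x /\ x < q) /\ f x = y.
have dim : def1 im by rewrite /im; dfn_tac.
have [[r [s [rs hrs]]]|[t ht]] := omin_dich omin dim; last first.
  have [x [px xq]] := itv_inj_infinite t pq inj.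
  by rewrite ht //; exists x.
have [s' [rs' ss']] := omin_dense omin rs; have [r' [rr' rs'']] := omin_dense omin rs'.
have [x1 [[px1 x1q] fx1]] := hrs r' rr' (lt_trans rs'' ss').
have [x2 [[px2 x2q] fx2]] := hrs s' rs' ss'.
(* [e] tells whether [f] is increasing, which determines the order of [x1] and [x2] *)
have x12 : if e then x1 < x2 else x2 < x1 by rewrite -hme // fx1 fx2.
have inside : forall x, (if e then x1 else x2) < x -> x < (if e then x2 else x1) ->
    [/\ p < x, x < q, r' < f x & f x < s'].
  move=> x ux xv; have [px xq] : p < x /\ x < q.
    move: ux xv; case: (e) => ux xv.
      by split; [exact: lt_trans ux|exact: lt_trans xv _].
    by split; [exact: lt_trans ux|exact: lt_trans xv _].
  split=> //; rewrite -?fx1 -?fx2 hme //; by move: ux xv; case: (e).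
exists (if e then x1 else x2), (if e then x2 else x1); split.
- by move: x12; case: (e).
- by move=> x ux xv; have [px xq _ _] := inside x ux xv; exact: sub.
move=> x ux xv l h lf fh; have [px xq rf fs] := inside x ux xv.
have [l' [l'f ll' rl']] : exists l', [/\ l' < f x, l < l' & r' < l'].
  have [|l' [ll l'f]] := @omin_dense _ _ _ omin (Order.max l r') (f x).
    by rewrite gt_max lf.
  by exists l'; move: ll; rewrite gt_max => /andP[].
have [h' [fh' h'h h's]] := omin_dense2 fh fs.
have [y1 [[py1 y1q] fy1]] := hrs l' (lt_trans rr' rl') (lt_trans l'f (lt_trans fs ss')).
have [y2 [[py2 y2q] fy2]] := hrs h' (lt_trans rr' (lt_trans rf fh')) (lt_trans h's ss').
rewrite -fy1 in l'f ll'; rewrite -fy2 in fh' h'h.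
have y1x := l'f; have xy2 := fh'; rewrite hme // in y1x; rewrite hme // in xy2.
exists (if e then y1 else y2), (if e then y2 else y1); split.
- by move: y1x xy2; case: (e).
- by move: y1x xy2; case: (e).
move=> y yl yh; have [py yq] : p < y /\ y < q.
  move: yl yh; case: (e) => yl yh.
    by split; [exact: lt_trans yl|exact: lt_trans yh _].
  by split; [exact: lt_trans yl|exact: lt_trans yh _].
split; [apply: lt_trans ll' _|apply: lt_trans h'h]; rewrite hme //;
  by move: yl yh; case: (e).
Qed.

(** Otherwise the points of discontinuity would contain an interval near the end,
    contrary to [continuous_somewhere]. *)
Lemma continuous_iend f e I : deff f -> oitv I ->
  iend e I (cont_at f).
Proof.
move=> df oI; have [//|] := iend_dec omin e oI (def_cont_at df).
move=> /(iend_shrink omin oI)[J [_ [[oJ [t tJ]] _ sub _ _]]].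
have [u [uJ tu]] := oitv_gt omin oJ tJ.
have [p [q [pq sub' h]]] := continuous_somewhere df tu.
have [x [px xq]] := omin_dense omin pq.
have [tx xu] := sub' x px xq.
by case: (sub x (oitv_convex tJ uJ (ltW tx) (ltW xu))).2; exact: h.
Qed.
End Monotone.

(** * Topology and morphisms of definable spaces *)

Section SpaceTopology.
Variables (d : Order.disp_t) (M : orderTopologicalType d) (S : fo_structure M).
Implicit Types X Y Z : defspace S.

(** A transition map is only known to be continuous on the overlap of two charts;
    in the chart [j] the set is cut out by the [z] near which the transition map
    sends the overlap into [W]. *)
Lemma open_chart X (i : dindex X) (W : set 'rV[M]_(ddim i)) : open W ->
  open [set y : X | ddom i y /\ W (dchart i y)].
Proof.
move=> oW; rewrite dopenE => j; have [V oV eV] := doverlap_open j i.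
have [g gE [_ _ /subspace_continuousP cg _]] := dtransition j i.
exists (V `&` [set z | nbhs z [set w |
    (dchart j @` (@ddom _ _ _ X j `&` ddom i)) w -> W (g w)]]).
  by apply: openI => //; rewrite openE => z /= /nbhs_interior; exact: filterS.
rewrite setIA -eV; apply/seteqP; split.
  move=> _ [y [[yi Wy] yj] <-]; split; first by exists y.
  apply: cg; first by exists y.
  by rewrite /from_subspace gE //; apply: open_nbhs_nbhs.
move=> _ [[y [yj yi] <-] /nbhs_singleton Wy]; exists y => //; split=> //.
by split=> //; rewrite -gE //; apply: Wy; exists y.
Qed.

Lemma nbhs_chart X (i : dindex X) (x : X) (U : set X) : ddom i x ->
  nbhs x U <-> exists2 W, nbhs (dchart i x) W &
    forall y, ddom i y -> W (dchart i y) -> U y.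
Proof.
move=> xi; split=> [|[W]].
  rewrite nbhsE => -[V [oV Vx] VU]; rewrite dopenE in oV; have [W oW eW] := oV i.
  have h y : ddom i y -> W (dchart i y) <-> V y.
    move=> yi; split=> [Wy|Vy].
      have : (dchart i @` ddom i `&` W) (dchart i y) by split=> //; exists y.
      by rewrite -eW => -[z [Vz zi] /(dchart_inj zi yi) <-].
    have : (dchart i @` (V `&` ddom i)) (dchart i y) by exists y.
    by rewrite eW => -[].
  exists W => [|y yi /(h _ yi)/VU//]; apply: open_nbhs_nbhs; split=> //; exact/h.
rewrite nbhsE => -[V [oV Vx] VW] h.
apply: (@filterS _ _ _ [set y : X | ddom i y /\ V (dchart i y)]).
  by move=> y [yi Vy]; apply: h => //; exact: VW.
by apply: open_nbhs_nbhs; split=> //; exact: open_chart.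
Qed.

Lemma nbhs_ddom X (i : dindex X) (x : X) : ddom i x -> nbhs x (ddom i : set X).
Proof. by move=> xi; apply/(nbhs_chart _ xi); exists setT => //; exact: filterT. Qed.

Lemma cvg_chart X T (F : set_system T) (FF : Filter F) (phi : T -> X) i (x : X) :
  ddom i x ->
  (phi @ F --> x) <->
  F [set t | ddom i (phi t)] /\ (dchart i \o phi @ F --> dchart i x).
Proof.
move=> xi; split=> [cv|[Fi cv] U /(nbhs_chart _ xi)[W Wx WU]].
  split; first by apply: (cv (ddom i)); exact: nbhs_ddom.
  move=> W Wx; have : nbhs x [set y : X | ddom i y -> W (dchart i y)].
    by apply/(nbhs_chart _ xi); exists W => // y _ Wy _.
  have := nbhs_ddom xi.
  by move=> /cv + /cv; apply: (@filterS2 _ F FF) => t ti; exact.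
by move: Fi (cv _ Wx); apply: (@filterS2 _ F FF) => t ti Wt; exact: WU.
Qed.

Lemma cvg_rV n T (F : set_system T) (FF : Filter F) (phi : T -> 'rV[M]_n)
    (u : 'rV[M]_n) :
  (forall k, (fun t => phi t ord0 k) @ F --> u ord0 k) -> phi @ F --> u.
Proof.
move=> cv U [P uP PU].
have : F (fun t => forall k, P ord0 k (phi t ord0 k)).
  by apply: filter_forall => k; apply: cv; exact: uP.
apply: (@filterS _ F FF) => t h; apply: PU => i k.
by rewrite (ord1 i); exact: h.
Qed.

Lemma cvg_dsub X (D : dset X) T (F : set_system T) (FF : Filter F) (phi : T -> dsub D)
    (x : dsub D) :
  (phi @ F --> x) <-> ((fun t => sub_val (phi t)) @ F --> sub_val x).
Proof.
split=> cv U.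
  rewrite nbhsE => -[V [oV Vx] VU].
  apply: (@filterS _ F FF (phi @^-1` [set y | V (sub_val y)])).
    by move=> t; exact: VU.
  by apply: cv; apply: open_nbhs_nbhs; split=> //; apply/open_subE; exists V.
rewrite nbhsE => -[V [/open_subE[W oW ->] Wx] WU].
apply: (@filterS _ F FF ((fun t => sub_val (phi t)) @^-1` W)).
  by move=> t; exact: WU.
by apply: cv; apply: open_nbhs_nbhs.
Qed.

(** The charts of [dprod X Y] are products, so its topology is the product topology. *)
Lemma cvg_dprod X Y T (F : set_system T) (FF : Filter F) (phi : T -> dprod X Y)
    (x : X) (y : Y) :
  (phi @ F --> ((x, y) : dprod X Y)) <->
  ((fun t => (phi t).1 : X) @ F --> x) /\ ((fun t => (phi t).2 : Y) @ F --> y).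
Proof.
have [i xi] := dcover x; have [j yj] := dcover y.
have pij : @ddom _ _ _ (dprod X Y) (i, j) (x, y) by [].
rewrite (cvg_chart FF phi pij) (cvg_chart FF _ xi) (cvg_chart FF _ yj).
split=> [[Fij cv]|[[Fi cx] [Fj cy]]].
  split; split.
  - by apply: (@filterS _ F FF) Fij => t [].
  - have := cvg_comp _ _ cv (@lsubmx_continuous _ _ _ _ _).
    rewrite /= row_mxKl; congr (_ `=>` _); congr (fmap _ F).
    by apply/funext => t /=; rewrite row_mxKl.
  - by apply: (@filterS _ F FF) Fij => t [].
  - have := cvg_comp _ _ cv (@rsubmx_continuous _ _ _ _ _).
    rewrite /= row_mxKr; congr (_ `=>` _); congr (fmap _ F).
    by apply/funext => t /=; rewrite row_mxKr.
split; first by apply: (@filterS2 _ F FF) Fi Fj.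
exact: cvg_row_mx cx cy.
Qed.

Lemma map_graph_def X Y (f : X -> Y) : is_hom f ->
  forall i j N (g : 'rV[M]_N -> 'rV[M]_(ddim i)) (h : 'rV[M]_N -> 'rV[M]_(ddim j)),
  dvec g -> dvec h -> dfn S (fun z => exists x, [/\ ddom i x, ddom j (f x),
    dchart i x = g z & dchart j (f x) = h z]).
Proof.
move=> [_ hf] i j N g h dg dh; have := dfn_mem (hf i j) (dvec_row dg dh).
by apply: dfn_ext => z; exact: map_graphP.
Qed.

Lemma map_graph_intro X Y (f : X -> Y) i j :
  dfn S (fun z : 'rV[M]_(ddim i + ddim j) => exists x, [/\ ddom i x, ddom j (f x),
    dchart i x = lsubmx z & dchart j (f x) = rsubmx z]) ->
  definable S (map_graph f (i := i) (j := j)).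
Proof.
apply: definable_ext => z; rewrite -{2}(hsubmxK z).
exact: iff_sym (map_graphP _ _ _).
Qed.

(** The graph of the identity in two charts is the transition map. *)
Lemma hom_id X : is_hom (fun x : X => x).
Proof.
split=> [x U //|i j]; have [g gE [dg _ _ _]] := dtransition i j.
apply: definable_ext dg => z; split.
  by move=> [_ [x [xi xj] <-] <-]; exists x; rewrite // gE.
by move=> [x [xi xj] <-]; exists (dchart i x); [exists x|rewrite gE].
Qed.

Lemma hom_comp X Y Z (f : X -> Y) (g : Y -> Z) :
  is_hom f -> is_hom g -> is_hom (g \o f).
Proof.
move=> hf hg; split=> [x|i k].
  exact: cvg_comp (hf.1 x) (hg.1 (f x)).
apply: map_graph_intro.
apply: (@dfn_ext _ _ _ _ (fun z => exists j, exists u,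
   (exists x, [/\ ddom i x, ddom j (f x), dchart i x = lsubmx z &
      dchart j (f x) = u]) /\
   (exists y, [/\ ddom j y, ddom k (g y), dchart j y = u &
      dchart k (g y) = rsubmx z]))).
  move=> z; split.
    move=> [j [u [[x [xi fj ex <-]] [y [yj yk /(dchart_inj yj fj) ey ez]]]]].
    by subst y; exists x.
  move=> [x [xi gk ex ez]]; have [j fj] := dcover (f x).
  by exists j, (dchart j (f x)); split; [exists x|exists (f x)].
apply: dfn_exfin => j; apply: dfn_exv.
by apply: dfn_and; apply: map_graph_def => //; dterm_tac.
Qed.

Lemma hom_sub_val X (D : dset X) : is_hom (sub_val (D := D)).
Proof.
suff H (i j : dindex X) :
    definable S (@map_graph _ _ _ (dsub D) X (@sub_val _ _ _ X D) i j).
  by split=> [x|//]; apply/(cvg_dsub (nbhs_filter x)).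
apply: (@map_graph_intro (dsub D) X).
apply: (@dfn_ext _ _ _ (ddim i + ddim j) (fun z =>
    (exists x, [/\ @ddom _ _ _ X i x, ddom j x,
    dchart i x = lsubmx z & dchart j x = rsubmx z]) /\
    (dchart i @` (D `&` @ddom _ _ _ X i)) (lsubmx z))).
  move=> z; split.
    move=> [[x [xi xj <- <-]] [y [Dy yi] /(dchart_inj yi xi) e]].
    by subst y; exists (sub_in Dy).
  move=> [x [xi xj <- <-]]; split; first by exists (sub_val x).
  by exists (sub_val x) => //; split=> //; exact: sub_valP.
apply: dfn_and; first by apply: (map_graph_def (hom_id X)); dterm_tac.
by apply: (dfn_mem (dset_def D i)); dterm_tac.
Qed.

(** A subspace has the charts of the ambient space, so the graphs of [h] in charts
    are those of its composite with the inclusion. *)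
Lemma hom_into_sub X Y (D : dset Y) (h : X -> dsub D) :
  is_hom (fun x => sub_val (h x)) -> is_hom h.
Proof.
by move=> [ch dh]; split=> [x|//]; apply/(cvg_dsub (nbhs_filter x)); exact: ch.
Qed.

Lemma hom_fst X Y : is_hom (fun w : dprod X Y => w.1 : X).
Proof.
split=> [[x y]|[i j] k].
  by have [] := (cvg_dprod (nbhs_filter ((x, y) : dprod X Y)) id x y).1.
apply: map_graph_intro.
apply: (@dfn_ext _ _ _ _ (fun z => (exists x, [/\ @ddom _ _ _ X i x, ddom k x,
    dchart i x = lsubmx (lsubmx z) & dchart k x = rsubmx z]) /\
    (dchart j @` @ddom _ _ _ Y j) (rsubmx (lsubmx z)))).
  move=> z; split.
    move=> [[x [xi xk ex ek]] [y yj ey]]; exists (x, y); split=> //.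
    by rewrite /= /prod_chart ex ey hsubmxK.
  move=> [[x y] [[/= xi yj] xk e ek]].
  by rewrite -e row_mxKl row_mxKr; split; [exists x|exists y].
apply: dfn_and; first by apply: (map_graph_def (hom_id X)); dterm_tac.
by apply: (dfn_mem (ddef j)); dterm_tac.
Qed.

Lemma hom_snd X Y : is_hom (fun w : dprod X Y => w.2 : Y).
Proof.
split=> [[x y]|[i j] k].
  by have [] := (cvg_dprod (nbhs_filter ((x, y) : dprod X Y)) id x y).1.
apply: map_graph_intro.
apply: (@dfn_ext _ _ _ _ (fun z => (exists y, [/\ @ddom _ _ _ Y j y, ddom k y,
    dchart j y = rsubmx (lsubmx z) & dchart k y = rsubmx z]) /\
    (dchart i @` @ddom _ _ _ X i) (lsubmx (lsubmx z)))).
  move=> z; split.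
    move=> [[y [yj yk ey ek]] [x xi ex]]; exists (x, y); split=> //.
    by rewrite /= /prod_chart ex ey hsubmxK.
  move=> [[x y] [[/= xi yj] xk e ek]].
  by rewrite -e row_mxKl row_mxKr; split; [exists y|exists x].
apply: dfn_and; first by apply: (map_graph_def (hom_id Y)); dterm_tac.
by apply: (dfn_mem (ddef i)); dterm_tac.
Qed.

Lemma hom_prod X Y X' Y' (f : X -> Y) (f' : X' -> Y') : is_hom f -> is_hom f' ->
  is_hom (fun w : dprod X X' => (f w.1, f' w.2) : dprod Y Y').
Proof.
move=> hf hf'; split=> [[x x']|[i i'] [j j']].
  apply/(cvg_dprod (nbhs_filter ((x, x') : dprod X X'))); split.
    exact: cvg_comp ((hom_fst X X').1 (x, x')) (hf.1 x).
  exact: cvg_comp ((hom_snd X X').1 (x, x')) (hf'.1 x').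
apply: map_graph_intro.
apply: (@dfn_ext _ _ _ _ (fun z =>
   (exists x, [/\ ddom i x, ddom j (f x), dchart i x = lsubmx (lsubmx z) &
      dchart j (f x) = lsubmx (rsubmx z)]) /\
   (exists x, [/\ ddom i' x, ddom j' (f' x), dchart i' x = rsubmx (lsubmx z) &
      dchart j' (f' x) = rsubmx (rsubmx z)]))).
  move=> z; split.
    move=> [[x [xi xj ex ex']] [y [yj yk ey ey']]]; exists (x, y); split=> //.
      by rewrite /= /prod_chart ex ey hsubmxK.
    by rewrite /= /prod_chart ex' ey' hsubmxK.
  move=> [[x y] [[/= xi yj] [/= xk yk] <- <-]].
  by rewrite !row_mxKl !row_mxKr; split; [exists x|exists y].
by apply: dfn_and; [apply: (map_graph_def hf)|apply: (map_graph_def hf')]; dterm_tac.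
Qed.

End SpaceTopology.

(** * Definable curves *)

Section Curves.
Variables (d : Order.disp_t) (M : orderTopologicalType d) (S : fo_structure M).
Hypothesis omin : o_minimal S.
Implicit Types X Y Z : defspace S.
Implicit Types I J : interval M.
Local Notation def1 := (def1 S).
Local Notation def2 := (def2 S).

Lemma oitvP (a b : itv_bound M) : itv_open_ends (Interval a b) ->
  (a < b)%O <-> oitv (Interval a b).
Proof.
move=> oI; split=> [ab|[_ [t]]]; last first.
  rewrite itv_boundlr => /andP[at_ tb].
  by apply: le_lt_trans at_ _; apply: lt_le_trans tb; rewrite bnd_simp.
split=> //; case: a b oI ab => [s a|[]] [s' b|[]] oI //.
- rewrite (itv_open_ends_lside oI) (itv_open_ends_rside oI) => ab.
  by have [z [az zb]] := omin_dense omin ab; exists z; rewrite itv_boundlr; apply/andP.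
- rewrite (itv_open_ends_lside oI) => _.
  by have [z az] := omin_nomax omin a; exists z; rewrite itv_boundlr; apply/andP.
- rewrite (itv_open_ends_rside oI) => _.
  by have [z az] := omin_nomin omin b; exists z; rewrite itv_boundlr; apply/andP.
- move=> _.
  by case: omin => -[z _] _ _ _; exists z; rewrite itv_boundlr; apply/andP.
Qed.

Lemma compactP X (C : set X) : definably_compact C <->
  forall I alpha, oitv I -> definable_curve C I alpha ->
    forall e, exists2 x, C x & alpha @ iend e I --> x.
Proof.
split=> [h [a b] alpha oI ca e|h a b alpha oI ab ca].
  have [|hl hr] := h a b alpha oI.1 _ ca; first exact/(oitvP oI.1).
  by case: e.
have oI' : oitv (Interval a b) by exact/(oitvP oI).
by split; [exact: (h _ _ oI' ca true)|exact: (h _ _ oI' ca false)].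
Qed.

Lemma curve_dfn X (C : set X) I alpha j N (f : 'rV[M]_N -> M)
    (u : 'rV[M]_N -> 'rV[M]_(ddim j)) :
  definable_curve C I alpha -> dterm f -> dvec u ->
  dfn S (fun z => [/\ f z \in I, ddom j (alpha (f z)) & dchart j (alpha (f z)) = u z]).
Proof.
move=> [_ _ /(_ j) dj] df du.
apply: dfn_ext (dfn_mem dj (dvec_row (dvec_const df) du)) => z; split.
  by move=> [t [tI tj] /eq_row_mx[/rowP/(_ ord0)]]; rewrite !mxE => <- <-.
by move=> [tI tj <-]; exists (f z).
Qed.

Lemma def_curve_mem X (C : set X) I alpha (K : set X) :
  definable_curve C I alpha -> is_definable K -> def1 (fun t => t \in I /\ K (alpha t)).
Proof.
move=> ca dK N f df.
apply: (@dfn_ext _ _ _ _ (fun z => exists j, exists u,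
   [/\ f z \in I, ddom j (alpha (f z)) & dchart j (alpha (f z)) = u] /\
   (dchart j @` (K `&` ddom j)) u)).
  move=> z; split=> [[j [u [[fI fj <-] [y [Ky yj] /(dchart_inj yj fj) <-]]]]//|[fI Kf]].
  have [j fj] := dcover (alpha (f z)).
  by exists j, (dchart j (alpha (f z))); split=> //; exists (alpha (f z)).
apply: dfn_exfin => j; apply: dfn_exv; apply: dfn_and.
  by apply: (curve_dfn ca); dterm_tac.
by apply: (dfn_mem (dK j)); dterm_tac.
Qed.

Lemma def_curve_eq X (C C' : set X) I J sigma gamma :
  definable_curve C J sigma -> definable_curve C' I gamma ->
  def2 (fun s t => [/\ s \in J, t \in I & sigma s = gamma t]).
Proof.
move=> cs cg N f g df dg.
apply: (@dfn_ext _ _ _ _ (fun z => exists j, exists u,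
   [/\ f z \in J, ddom j (sigma (f z)) & dchart j (sigma (f z)) = u] /\
   [/\ g z \in I, ddom j (gamma (g z)) & dchart j (gamma (g z)) = u])).
  move=> z; split.
    by move=> [j [u [[fI fj <-] [gI gj /(dchart_inj gj fj)]]]].
  move=> [fJ gI e]; have [j fj] := dcover (sigma (f z)).
  by exists j, (dchart j (sigma (f z))); split=> //; rewrite -e.
apply: dfn_exfin => j; apply: dfn_exv; apply: dfn_and.
  by apply: (curve_dfn cs); dterm_tac.
by apply: (curve_dfn cg); dterm_tac.
Qed.

Lemma curve_near X (C : set X) I alpha t (U : set X) :
  definable_curve C I alpha -> t \in I -> nbhs (alpha t) U ->
  nbhs t (fun s => s \in I -> U (alpha s)).
Proof.
by move=> [_ /subspace_continuousP ca _] tI /(ca t tI).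
Qed.

Lemma curve_restrict X (C D : set X) I J alpha : definable_curve C I alpha ->
  (forall t, t \in J -> t \in I /\ D (alpha t)) -> definable_curve D J alpha.
Proof.
move=> ca JI; split.
- by move=> t /JI[].
- have [_ c _] := ca; apply: continuous_subspaceW c => t /= tJ; exact: (JI t tJ).1.
move=> j; have dn : dfn S (fun z : 'rV[M]_(1 + ddim j) =>
    [/\ lsubmx z ord0 ord0 \in I, ddom j (alpha (lsubmx z ord0 ord0)) &
      dchart j (alpha (lsubmx z ord0 ord0)) = rsubmx z] /\ lsubmx z ord0 ord0 \in J).
  apply: dfn_and; first by apply: (curve_dfn ca); dterm_tac.
  by apply: (dfn_def1 (@def1_itv _ _ _ _)); dterm_tac.
apply: definable_ext dn => z; split=> [[[tI tj e] tJ]|[t [tJ tj] <-]].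
  exists (lsubmx z ord0 ord0) => //; rewrite e -[RHS]hsubmxK; congr row_mx.
  by apply/rowP => k; rewrite mxE (ord1 k).
rewrite /dfn /= row_mxKl row_mxKr mxE; split=> //; split=> //; exact: (JI t tJ).1.
Qed.

Lemma curve_comp X Y (f : X -> Y) (C : set X) (D : set Y) I alpha : is_hom f ->
  definable_curve C I alpha -> (forall t, t \in I -> D (f (alpha t))) ->
  definable_curve D I (f \o alpha).
Proof.
move=> hf ca CD; split=> //.
  apply/subspace_continuousP => t tI; have [_ /subspace_continuousP c _] := ca.
  exact: cvg_comp (c t tI) (hf.1 _).
move=> j; have dn : dfn S (fun z : 'rV[M]_(1 + ddim j) => exists i, exists u,
    [/\ lsubmx z ord0 ord0 \in I, ddom i (alpha (lsubmx z ord0 ord0)) &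
      dchart i (alpha (lsubmx z ord0 ord0)) = u] /\
    exists x, [/\ ddom i x, ddom j (f x), dchart i x = u & dchart j (f x) = rsubmx z]).
  apply: dfn_exfin => i; apply: dfn_exv; apply: dfn_and.
    by apply: (curve_dfn ca); dterm_tac.
  by apply: map_graph_def => //; dterm_tac.
apply: definable_ext dn => z; split.
  move=> [i [u [[tI ti <-] [x [xi fj /(dchart_inj xi ti) e ez]]]]]; subst x.
  exists (lsubmx z ord0 ord0) => //; rewrite /= ez -[RHS]hsubmxK; congr row_mx.
  by apply/rowP => k; rewrite mxE (ord1 k).
move=> [t [tI tj] <-]; rewrite /= row_mxKl row_mxKr mxE; have [i ti] := dcover (alpha t).
exists i, (dchart i (alpha t)); split=> //; by exists (alpha t).
Qed.

Lemma is_definable1 X (x : X) : is_definable [set x].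
Proof.
move=> i; have dn : dfn S (fun z => ddom i x /\ z = dchart i x).
  apply: dfn_and; first exact: dfn_prop.
  apply: (@dfn_ext _ _ _ _ (fun z => forall k, z ord0 k = dchart i x ord0 k)).
    by move=> z; split=> [h|->//]; apply/rowP.
  by apply: dfn_allfin => k; apply: dfn_eq; [apply: dvec_id|exact: dterm_cst].
apply: definable_ext dn => z; split=> [[xi ->]|[y [-> xi] <-]] //.
by exists x.
Qed.

Lemma cvg_const_near X (T : Type) (F : set_system T) (FF : Filter F) (phi : T -> X) x :
  F (fun t => phi t = x) -> phi @ F --> x.
Proof.
move=> h U /nbhs_singleton Ux; apply: (@filterS _ F FF) h => t /= tx.
by rewrite /= tx.
Qed.

Lemma compact1 X (x : X) : definably_compact [set x].
Proof.
apply/compactP => I alpha oI [ax _ _] e; exists x => //.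
have FF := iend_filter omin e oI; apply: cvg_const_near.
by apply: (@filterS _ (iend e I) FF _ _ _ (iend_itv e oI)) => t /ax.
Qed.

Lemma iend_shrink_cvg X (alpha : M -> X) e I J (x : X) :
  (forall B : set M, iend e I B <-> iend e J B) ->
  alpha @ iend e I --> x <-> alpha @ iend e J --> x.
Proof. by move=> h; split=> cv U /cv/h. Qed.

Definition arc X I (gamma : M -> X) (y : bool -> X) : set X :=
  [set x | (exists2 t, t \in I & gamma t = x) \/ exists e, y e = x].

Lemma arc_definable X I gamma y : definable_curve setT I gamma ->
  is_definable (@arc X I gamma y).
Proof.
move=> cg i.
have dn : dfn S (fun u =>
    (exists t, [/\ t \in I, ddom i (gamma t) & dchart i (gamma t) = u]) \/
    exists e, (dchart i @` ([set y e] `&` ddom i)) u).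
  apply: dfn_or; first by apply: dfn_ex; apply: (curve_dfn cg); dterm_tac.
  by apply: dfn_exfin => e; apply: is_definable1.
apply: definable_ext dn => u; split.
  move=> [[t [tI ti <-]]|[e [x [-> yi] <-]]].
    by exists (gamma t) => //; split=> //; left; exists t.
  by exists (y e) => //; split=> //; right; exists e.
move=> [x [[[t tI <-]|[e <-]] xi] <-]; first by left; exists t.
by right; exists e, (y e).
Qed.

(** Assume that a curve [sigma] in the arc has no limit in it at an end. Then near
    that end it avoids the two points [y e], so it lies in the image of [gamma];
    let [T s t] say that [t] is the least element of the fibre of [gamma] over
    [sigma s]. Whether eventually [m < t] is a definable property of [m] that defines
    a cut of [I]. Its position, be it a point of [I] or one of the ends, is the
    limit of [t], and [gamma] is continuous there or converges. *)
Lemma arc_compact X I gamma y : (forall x : X, closed [set x]) -> oitv I ->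
  definable_curve setT I gamma -> (forall e, gamma @ iend e I --> y e) ->
  definably_compact (@arc X I gamma y).
Proof.
move=> cl1 oI cg gy; apply/compactP => J sigma oJ cs e.
have FF := iend_filter omin e oJ.
have dy b : def1 (fun s => s \in J /\ sigma s = y b).
  exact: (def_curve_mem cs (is_definable1 (y b))).
have ycase b : (forall x, ~ (arc I gamma y x /\ sigma @ iend e J --> x)) ->
    iend e J (fun s => ~ (s \in J /\ sigma s = y b)).
  move=> no; have [h|//] := iend_dec omin e oJ (dy b).
  case: (no (y b)); split; first by right; exists b.
  by apply: cvg_const_near; apply: (@filterS _ _ FF) h => t [].
apply: contrapT => no'; have no x : ~ (arc I gamma y x /\ sigma @ iend e J --> x).
  by move=> [Kx cx]; apply: no'; exists x.
have hJ := iend_itv e oJ; have ht := ycase true no; have hf := ycase false no.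
pose E s t := [/\ s \in J, t \in I & sigma s = gamma t].
pose T s t := E s t /\ forall t', E s t' -> (t <= t')%O.
have dE : def2 E by exact: def_curve_eq cs cg.
have dT : def2 T by rewrite /T => N f g df dg; dfn_tac.
have lift : iend e J (fun s => exists t, T s t).
  apply: (@filterS3 _ _ FF) hJ ht hf => s sJ nt nf.
  have [t0 [t0I s0]] : exists t0, t0 \in I /\ gamma t0 = sigma s.
    have [Ks _ _] := cs; have [[t tI ts]|[[] ys]] := Ks s sJ; first by exists t.
      by case: nt.
    by case: nf.
  (* the fibre is closed in [I] and stays away from the left end of [I], where
     [gamma] converges to a point other than [sigma s]; so it has a least element *)
  have away x : sigma s <> x -> nbhs x (~` [set sigma s]).
    move=> sx; apply: open_nbhs_nbhs; split; first exact: closed_openC.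
    by move=> /= xs; apply: sx.
  have /(gy true)[c cI hc] : nbhs (y true) (~` [set sigma s]).
    by apply: away => sy; apply: nt.
  (* lower bounds of the fibre *)
  pose L m := forall t, E s t -> (m <= t)%O.
  have dEs := def2_l s dE.
  have dL : def1 L by move=> N f df; rewrite /L; dfn_tac.
  have Lc : L c.
    move=> t [_ tI st]; rewrite leNgt; apply/negP => tc.
    by case: (hc t); [split|rewrite st].
  have [|i [iub ilub]] := omin_sup omin (w := t0) dL Lc.
    by move=> m Lm; apply: Lm; split; rewrite ?s0.
  have Li : L i.
    move=> t Et; rewrite leNgt; apply/negP => /ilub[m [Lm tm]].
    by have := Lm t Et; rewrite leNgt tm.
  have iI : i \in I.
    by apply: (oitv_convex cI t0I (iub _ Lc)); apply: Li; split; rewrite ?s0.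
  exists i; split=> //; split=> //; apply: contrapT => si.
  have /(nbhs_oo omin)[p [q [pi iq hpq]]] := curve_near cg iI (away _ si).
  have [q' [iq' q'q]] := omin_dense omin iq.
  have : L q'.
    move=> t Et; have it := Li t Et; rewrite leNgt; apply/negP => tq'.
    case: Et => _ tI st; apply: (hpq t) => //; first exact: lt_le_trans it.
    exact: lt_trans q'q.
  by move=> /iub; rewrite leNgt iq'.
pose U m := iend e J (fun s => exists t, T s t /\ (m < t)%O).
have dU : def1 U by apply: def_iend => N f g df dg; dfn_tac.
have nU m : ~ U m -> iend e J (fun s => exists t, T s t /\ (t <= m)%O).
  have dR : def1 (fun s => exists t, T s t /\ (m < t)%O) by dfn_tac.
  move=> nUm; have [//|] := iend_dec omin e oJ dR; apply: (@filterS2 _ _ FF) lift.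
  move=> s [t Tst] nex; exists t; split=> //; rewrite leNgt; apply/negP => mt.
  by apply: nex; exists t.
have down x z : (x < z)%O -> U z -> U x.
  move=> xz; apply: (@filterS _ _ FF) => s [t [Tst zt]]; exists t; split=> //.
  exact: lt_trans zt.
(* the cut is at the left end *)
have [[u uI Uu]|noU] := pselect (exists2 u, u \in I & U u); last first.
  apply: (no (y true)); split; first by right; exists true.
  move=> O /(gy true)[m mI hm]; have [m' [m'I m'm]] := oitv_lt omin oI.1 mI.
  have /nU : ~ U m' by move=> Um'; apply: noU; exists m'.
  apply: (@filterS _ _ FF) => s [t [[[sJ tI st] _] tm']] /=; rewrite st.
  by apply: hm; split=> //; exact: le_lt_trans m'm.
(* the cut is at the right end *)
have [[w wI nUw]|noU] := pselect (exists2 w, w \in I & ~ U w); last first.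
  apply: (no (y false)); split; first by right; exists false.
  move=> O /(gy false)[m mI hm].
  have : U m by apply: contrapT => nUm; apply: noU; exists m.
  apply: (@filterS _ _ FF) => s [t [[[sJ tI st] _] tm']] /=; rewrite st.
  exact: hm.
have [c [uc cw hU hnU]] := omin_cut omin dU Uu nUw down.
have cI : c \in I by exact: oitv_convex uI wI uc cw.
apply: (no (gamma c)); split; first by left; exists c.
move=> O /(curve_near cg cI)/(nbhs_oo omin)[p [q [pc cq hpq]]].
have [q' [cq' q'q]] := omin_dense omin cq.
apply: (@filterS2 _ _ FF) (hU p pc) (nU _ (hnU _ cq')).
move=> s [t [[[sJ tI st] tmin] pt]] [t' [[Et' _] t'q']] /=; rewrite st.
by apply: hpq => //; apply: le_lt_trans q'q; exact: le_trans (tmin _ Et') t'q'.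
Qed.

End Curves.

(** * Definably proper maps *)

Section Proper.
Variables (d : Order.disp_t) (M : orderTopologicalType d) (S : fo_structure M).
Hypothesis omin : o_minimal S.
Implicit Types X Y Z : defspace S.
Implicit Types I J : interval M.

(** The hypothesis on the category, for a single space. *)
Definition compacts_closed X : Prop :=
  forall K : dset X, definably_compact K -> closed (K : set X).

Lemma closed1 X (x : X) : compacts_closed X -> closed [set x].
Proof. by move=> /(_ (DSet (is_definable1 x)) (@compact1 _ _ _ omin _ x)). Qed.

Lemma cvg_iend_near X e I (alpha beta : M -> X) (x : X) : oitv I ->
  (forall t, t \in I -> alpha t = beta t) ->
  alpha @ iend e I --> x -> beta @ iend e I --> x.
Proof.
move=> oI ab cv U /cv h; have FF := iend_filter omin e oI.
apply: (@filterS2 _ _ FF _ _ _ _ (iend_itv e oI)) h => t /= tI Ut.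
by rewrite /= -ab.
Qed.

(** A curve that converges at one end can be cut so as to converge at both: the new
    end is a point where the curve is continuous. *)
Lemma curve_shrink X (C : set X) I alpha e (x : X) (A : set M) : oitv I ->
  definable_curve C I alpha -> alpha @ iend e I --> x -> iend e I A ->
  exists J c (y : bool -> X),
    [/\ oitv J, forall t, t \in J -> t \in I /\ A t,
      forall B : set M, iend e I B <-> iend e J B,
      forall b, alpha @ iend b J --> y b &
      [/\ A c, c \in I, y e = x & y (~~ e) = alpha c]].
Proof.
move=> oI ca cx FA; have [J [c [oJ [Ac cI] sub eq cc]]] := iend_shrink omin oI FA.
exists J, c, (fun b => if b == e then x else alpha c); split=> //; last first.
  by rewrite eqxx; split=> //; case: (e).
move=> b; have [->|be] := eqVneq b e; first exact/(iend_shrink_cvg _ _ eq).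
have -> : b = ~~ e by case: (b) (e) be => -[].
move=> U /(curve_near ca cI)/cc; have FF := iend_filter omin (~~ e) oJ.
apply: (@filterS2 _ _ FF _ _ _ _ (iend_itv (~~ e) oJ)) => t tJ; apply.
exact: (sub t tJ).1.
Qed.

(** If [alpha] is eventually equal to [y], then its limit [x] lies in the closed set
    [[set y]]. Otherwise [alpha] avoids [y] on a shorter interval with the same end;
    the arc with limit [x] at that end is closed, so it contains [y], and [y] can
    only be [x]. *)
Lemma curve_limit_unique X (C : set X) I alpha e (x y : X) :
  compacts_closed X -> oitv I -> definable_curve C I alpha ->
  alpha @ iend e I --> x -> alpha @ iend e I --> y -> x = y.
Proof.
move=> cX oI ca cx cy; have cl1 (z : X) : closed [set z] by exact: closed1.
have FF := iend_filter omin e oI.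
have [h|h] := iend_dec omin e oI (def_curve_mem ca (is_definable1 y)).
  apply: (closed_cvg _ (cl1 y)) cx; apply: (@filterS _ _ FF) h => t [] //.
have [J [c [l [oJ sub eq cl [Ac cI le lc]]]]] := curve_shrink oI ca cx h.
have cJ : definable_curve setT J alpha.
  by apply: (curve_restrict ca) => t /sub[].
have GG := iend_filter omin e oJ.
have := cX (DSet (arc_definable l cJ)) (arc_compact omin cl1 oJ cJ cl).
move=> /(closed_cvg (F := iend e J))/(_ _ y (iffLR (iend_shrink_cvg _ _ eq) cy)) /=.
case=> [|[t tJ ty]|[b]].
- by apply: (@filterS _ _ GG) (iend_itv e oJ) => t tJ; left; exists t.
- by have [tI []] := sub t tJ.
have [->|be] := eqVneq b e; first by rewrite le.
have -> : b = ~~ e by case: (b) (e) be => -[].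
by rewrite lc => cy'; case: Ac.
Qed.

(** Preimages under morphisms are definable, and the image of a curve in the preimage
    of [K] is a curve in [K], whose limit can be assumed. *)
Lemma proper_intro X Y (f : X -> Y) : is_hom f ->
  (forall (K : dset Y), definably_compact K -> forall I alpha e (y : Y), oitv I ->
    definable_curve (f @^-1` K) I alpha -> definable_curve K I (f \o alpha) ->
    dset_set K y -> f \o alpha @ iend e I --> y ->
    exists2 x, dset_set K (f x) & alpha @ iend e I --> x) ->
  definably_proper f.
Proof.
move=> hf h; split=> // K cK; split.
  exact: (@preimage_definable _ _ _ _ _ (DHom hf) K).
apply/(compactP omin) => I alpha oI ca e.
have cfa : definable_curve K I (f \o alpha).
  by apply: (curve_comp hf ca); case: ca.
have [y Ky cy] := (compactP omin K).1 cK I _ oI cfa e.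
exact: (h K cK I alpha e y).
Qed.

(** The arc of the image curve near the end is definably compact, and [alpha] is a
    curve in its preimage. *)
Lemma proper_lift X Y (f : X -> Y) (C : set X) I alpha e (y : Y) :
  compacts_closed Y -> definably_proper f -> oitv I -> definable_curve C I alpha ->
  f \o alpha @ iend e I --> y -> exists x : X, alpha @ iend e I --> x.
Proof.
move=> cY [hf pf] oI ca cy.
have cfa : definable_curve setT I (f \o alpha) by apply: (curve_comp hf ca).
have [J [c [l [oJ sub eq cl _]]]] := curve_shrink oI cfa cy (iend_itv e oI).
have cfJ : definable_curve setT J (f \o alpha).
  by apply: (curve_restrict cfa) => t /sub[].
have cl1 (z : Y) : closed [set z] by exact: closed1.
have [_] := pf (DSet (arc_definable l cfJ)) (arc_compact omin cl1 oJ cfJ cl).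
move=> /(compactP omin) h; have [|x _ cx] := h J alpha oJ _ e.
  apply: (curve_restrict ca) => t tJ; split; first exact: (sub t tJ).1.
  by left; exists t.
by exists x; apply/(iend_shrink_cvg _ _ eq).
Qed.

(** The limit of the image curve lies in the closed range of [f], from where the
    inverse homeomorphism carries it back. *)
Lemma proper_closed_immersion X Y (f : dhom X Y) :
  closed_immersion f -> definably_proper f.
Proof.
move=> [[_ [g [cg fg gf]]] clf]; apply: proper_intro (homP f) _.
move=> K cK I alpha e y oI ca cfa Ky cy.
have FF := iend_filter omin e oI.
have [x _ fx] : range f y.
  by apply: closed_cvg clf _ _ cy; apply: filterE => t; exists (alpha t).
rewrite -fx in Ky cy; exists x => //.
have : corestrict f \o alpha @ iend e I --> corestrict f x by exact/(cvg_dsub FF).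
move=> h; have := cvg_comp _ _ h (cg _); rewrite fg.
by rewrite (_ : g \o _ = alpha) //; apply/funext => t /=; rewrite fg.
Qed.

Lemma proper_comp X Y Z (f : X -> Y) (g : Y -> Z) :
  definably_proper f -> definably_proper g -> definably_proper (g \o f).
Proof.
move=> [hf pf] [hg pg]; split; first exact: hom_comp.
by move=> K /pg[dK cK]; exact: (pf (DSet dK) cK).
Qed.

Lemma proper_id X : definably_proper (fun x : X => x).
Proof. by split=> [|K cK]; [exact: hom_id|split=> //; exact: dset_def]. Qed.

(** Both components of the curve converge, by [proper_lift]. Uniqueness of limits
    in [Y] and [Y'] identifies the images of their limits [x] and [x'] with the
    components of the limit [k] of the image curve; this puts [(x, x')] in the fibre
    product, and in the preimage of [K]. *)
Lemma proper_fiber_map X Y X' Y' Z (p : dhom X Z) (q : dhom Y Z) (f : X -> Y)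
    (qf : q \o f =1 p) (p' : dhom X' Z) (q' : dhom Y' Z) (f' : X' -> Y')
    (qf' : q' \o f' =1 p') : compacts_closed Y -> compacts_closed Y' ->
  definably_proper f -> definably_proper f' ->
  definably_proper (fiber_map qf qf' : fiber_prod p p' -> fiber_prod q q').
Proof.
move=> cY cY' pf pf'; have [hf _] := pf; have [hf' _] := pf'.
apply: proper_intro.
  apply: hom_into_sub.
  exact: (hom_comp (@hom_sub_val _ _ _ _ (DSet (fiber_definable p p')))
    (hom_prod hf hf')).
move=> K cK I w e k oI cw _ Kk ck.
have FF := iend_filter omin e oI.
have cw0 := curve_comp (D := setT) (@hom_sub_val _ _ _ _ _) cw (fun _ _ => Logic.I).
have cw1 := curve_comp (D := setT) (@hom_fst _ _ _ X X') cw0 (fun _ _ => Logic.I).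
have cw2 := curve_comp (D := setT) (@hom_snd _ _ _ X X') cw0 (fun _ _ => Logic.I).
have qk := sub_valP k; have := (cvg_dsub FF _ _).1 ck.
case ek : (sub_val k) qk => [k1 k2] /= qk.
move=> /(cvg_dprod FF)[/= ck1 ck2].
have [x cx] := proper_lift cY pf oI cw1 ck1.
have [x' cx'] := proper_lift cY' pf' oI cw2 ck2.
have cf1 := curve_comp (D := setT) hf cw1 (fun _ _ => Logic.I).
have cf2 := curve_comp (D := setT) hf' cw2 (fun _ _ => Logic.I).
have fx : f x = k1.
  by apply: (curve_limit_unique cY oI cf1 _ ck1); exact: cvg_comp cx (hf.1 x).
have fx' : f' x' = k2.
  by apply: (curve_limit_unique cY' oI cf2 _ ck2); exact: cvg_comp cx' (hf'.1 x').
have pxx' : p x = p' x' by rewrite -qf -qf' /= fx fx'.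
pose xx' := @sub_in _ _ _ (dprod X X') (DSet (fiber_definable p p')) (x, x') pxx'.
exists xx'.
  have -> // : fiber_map qf qf' xx' = k.
  by apply: val_inj; rewrite [RHS]ek /= fx fx'.
by apply/(cvg_dsub FF)/(cvg_dprod FF).
Qed.

(** Since [g \o f \o alpha] converges, [proper_lift] for [g \o f] applies. *)
Lemma proper_cancel X Y Z (f : dhom X Y) (g : dhom Y Z) : compacts_closed Y ->
  compacts_closed Z -> definably_proper (g \o f) -> definably_proper f.
Proof.
move=> cY cZ pgf; apply: proper_intro (homP f) _.
move=> K cK I alpha e y oI ca cfa Ky cy.
have FF := iend_filter omin e oI.
have cgy : (g \o f) \o alpha @ iend e I --> g y.
  exact: cvg_comp cy ((homP g).1 y).
have [x cx] := proper_lift cZ pgf oI ca cgy.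
exists x => //; apply: (closed_cvg _ (cY K cK)) (cvg_comp _ _ cx ((homP f).1 x)).
by apply: (@filterS _ _ FF) (iend_itv e oI) => t; have [h _ _] := cfa; exact: h.
Qed.

(** Outside [I] the lift takes an arbitrary value, that at [t0]. *)
Lemma curve_dsub X (D : dset X) (C : set X) I alpha :
  oitv I -> definable_curve C I alpha ->
  (forall t, t \in I -> dset_set D (alpha t)) ->
  exists beta : M -> dsub D, (forall t, t \in I -> sub_val (beta t) = alpha t) /\
    definable_curve (sub_val (D := D) @^-1` C) I beta.
Proof.
move=> [_ [t0 t0I]] [aC ca da] aD.
pose beta t : dsub D := if pselect (t \in I) is left tI then sub_in (aD t tI)
  else sub_in (aD t0 t0I).
have bE t : t \in I -> sub_val (beta t) = alpha t by rewrite /beta; case: pselect.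
exists beta; split=> //; split.
- by move=> t tI /=; rewrite bE //; exact: aC.
- apply/subspace_continuousP => t tI.
  apply/(cvg_dsub (within_filter _ (nbhs_filter t))); rewrite bE //.
  move: ca => /subspace_continuousP/(_ t tI) ca U /ca.
  apply: (@filterS _ (nbhs t)) => s h sI; rewrite /= bE //; exact: h.
move=> j; apply: definable_ext (da j) => z; split=> -[t [tI tj] <-]; exists t => //.
- by split=> //; rewrite /= /sub_dom /= -[val _]/(sub_val _) bE.
- by rewrite /= /sub_chart -[val _]/(sub_val _) bE.
- by split=> //; rewrite /= -bE.
- by rewrite -bE.
Qed.

Lemma dsub_image_definable X (D : dset X) (K : dset (dsub D)) :
  is_definable (sub_val (D := D) @` K).
Proof.
move=> i; apply: definable_ext (dset_def K i) => z; split.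
  by move=> [x [Kx xi] <-]; exists (sub_val x) => //; split=> //; exists x.
by move=> [_ [[x Kx <-] xi] <-]; exists x.
Qed.

Lemma dsub_image_compact X (D : dset X) (K : set (dsub D)) :
  definably_compact K -> definably_compact (sub_val (D := D) @` K).
Proof.
move=> /(compactP omin) cK; apply/(compactP omin) => I alpha oI ca e.
have [|beta [bE cb]] := curve_dsub (D := D) oI ca.
  by have [h _ _] := ca => t /h[x _ <-]; exact: sub_valP.
have FF := iend_filter omin e oI.
have cb' : definable_curve K I beta.
  apply: (curve_restrict cb) => t tI; split=> //.
  by have [h _ _] := cb; have [x Kx /val_inj <-] := h t tI.
have [x Kx cx] := cK I beta oI cb' e; exists (sub_val x); first by exists x.
by apply: (cvg_iend_near oI bE); apply/(cvg_dsub FF).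
Qed.

Lemma hom_restrict_over X Y (f : dhom X Y) (V : dset Y) : is_hom (restrict_over f V).
Proof. by apply: hom_into_sub; apply: (hom_comp (@hom_sub_val _ _ _ _ _) (homP f)). Qed.

Lemma proper_restrict X Y (f : dhom X Y) (V : dset Y) : definably_proper f ->
  definably_proper (restrict_over f V).
Proof.
move=> [_ pf]; apply: (proper_intro (@hom_restrict_over _ _ f V)).
move=> K cK I alpha e y oI ca cfa Ky cy.
have [_ /(compactP omin)h] := pf (DSet (dsub_image_definable K)) (dsub_image_compact cK).
have FF := iend_filter omin e oI.
have [|x [z Kz zx] cx] := h I (fun t => sub_val (alpha t)) oI _ e.
  apply: (curve_comp (@hom_sub_val _ _ _ _ _) ca) => t tI.
  by have [k _ _] := ca; exists (restrict_over f V (alpha t)) => //; exact: k.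
have Vx : dset_set V (f x) by rewrite -zx; exact: sub_valP.
pose x' := @sub_in _ _ _ X (preim_dset f V) x Vx.
exists x'; last exact/(cvg_dsub FF).
have -> // : restrict_over f V x' = z.
by apply: val_inj; rewrite -[RHS]/(sub_val z) zx.
Qed.

(** The limit [y] of the image curve lies in some open [V i], so near the end the
    curve runs over [V i] and [proper_lift] applies to the restriction of [f]
    over it. *)
Lemma proper_local X Y (f : dhom X Y) (n : nat) (V : 'I_n -> dset Y) :
  compacts_closed Y -> (forall i, compacts_closed (dsub (V i))) ->
  (forall i, open (V i : set Y)) -> [set: Y] = \bigcup_i (V i : set Y) ->
  (forall i, definably_proper (restrict_over f (V i))) -> definably_proper f.
Proof.
move=> cY cV oV VT pf; apply: proper_intro (homP f) _.
move=> K cK I alpha e y oI ca cfa Ky cy.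
have FF := iend_filter omin e oI.
have [i _ Viy] : (\bigcup_i (V i : set Y)) y by rewrite -VT.
have FV : iend e I (fun t => dset_set (V i) (f (alpha t))).
  by apply: (cy (V i : set Y)); apply: open_nbhs_nbhs.
have [J [_ [oJ _ sub eq _]]] := iend_shrink omin oI FV.
have caJ : definable_curve setT J alpha by apply: (curve_restrict ca) => t /sub[].
have [|beta [bE cb]] := curve_dsub (D := preim_dset f (V i)) oJ caJ.
  by move=> t /sub[].
have GG := iend_filter omin e oJ.
have cyJ : f \o alpha @ iend e J --> y by exact/(iend_shrink_cvg _ _ eq).
pose y' := @sub_in _ _ _ Y (V i) y Viy.
have [|x cx] := @proper_lift _ _ _ _ _ _ e y' (cV i) (pf i) oJ cb.
  apply/(cvg_dsub GG); apply: (cvg_iend_near oJ _ cyJ) => t tJ.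
  by rewrite -[RHS]/(f (sub_val (beta t))) bE.
have ax : alpha @ iend e I --> sub_val x.
  apply/(iend_shrink_cvg _ _ eq); apply: (cvg_iend_near oJ bE); exact/(cvg_dsub GG).
exists (sub_val x) => //.
apply: (closed_cvg _ (cY K cK)) (cvg_comp _ _ ax ((homP f).1 _)).
by apply: (@filterS _ _ FF) (iend_itv e oI) => t; have [h _ _] := cfa; exact: h.
Qed.

End Proper.

(** * Lifting curves with Skolem functions *)

Section Skolem.
Variables (d : Order.disp_t) (M : orderTopologicalType d) (S : fo_structure M).
Hypothesis omin : o_minimal S.
Implicit Types X Y Z : defspace S.
Implicit Types I J : interval M.

Lemma iend_pigeonhole e I (T : finType) (P : T -> M -> Prop) : oitv I ->
  (forall i, def1 S (P i)) -> iend e I (fun t => exists i, P i t) ->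
  exists i, iend e I (P i).
Proof.
move=> oI dP h; apply: contrapT => no; have FF := iend_filter omin e oI.
have : iend e I (fun t => forall i, ~ P i t).
  apply: (@filter_forall _ _ _ _ FF) => i.
  by have [hi|//] := iend_dec omin e oI (dP i); case: no; exists i.
move=> h'; have [t [[i Pi] /(_ i)]] := filter_ex (filterI h h').
exact.
Qed.

(** Near the end a single chart [i] of [X] contains points of all the fibres, so
    Skolem functions apply to [G i t u], which says that [u] is the image in this
    chart of a point of [L] above [gamma t]. The coordinates of the resulting function
    [h] are definable functions of one variable, hence continuous near the end,
    where [h] is therefore the expression in the chart of a continuous curve. *)
Lemma curve_lift_near_end X Y (f : X -> Y) (L : set X) (C : set Y) I gamma e :
  definable_skolem S -> is_hom f -> is_definable L -> oitv I ->
  definable_curve C I gamma ->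
  (forall t, t \in I -> exists2 x, L x & f x = gamma t) ->
  exists J beta, [/\ oitv J, forall t, t \in J -> t \in I,
    forall B : set M, iend e I B <-> iend e J B,
    definable_curve L J beta & forall t, t \in J -> f (beta t) = gamma t].
Proof.
move=> sk hf dL oI cg fibre; have FF := iend_filter omin e oI.
pose G (i : dindex X) (t : M) (u : 'rV[M]_(ddim i)) := t \in I /\
  exists x, [/\ L x, ddom i x, dchart i x = u & f x = gamma t].
have dG i N (g : 'rV[M]_N -> M) (u : 'rV[M]_N -> 'rV[M]_(ddim i)) :
    dterm g -> dvec u -> dfn S (fun z => G i (g z) (u z)).
  move=> dg du; apply: (@dfn_ext _ _ _ _ (fun z => (dchart i @` (L `&` ddom i)) (u z) /\
     exists j, exists v, [/\ g z \in I, ddom j (gamma (g z)) &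
         dchart j (gamma (g z)) = v] /\
       exists x, [/\ ddom i x, ddom j (f x), dchart i x = u z & dchart j (f x) = v])).
    move=> z; split.
      move=> [[x [Lx xi] ex] [j [v [[tI tj <-] [y [yi fj ey]]]]]].
      move=> /(dchart_inj fj tj) e'.
      split=> //; exists x; split=> //; rewrite -e'; congr f.
      by apply: (dchart_inj xi yi); rewrite ex ey.
    move=> [tI [x [Lx xi ex fx]]]; split; first by exists x.
    have [j tj] := dcover (gamma (g z)); exists j, (dchart j (gamma (g z))); split=> //.
    by exists x; split=> //; rewrite fx.
  apply: dfn_and; first by apply: (dfn_mem (dL i)); dterm_tac.
  apply: dfn_exfin => j; apply: dfn_exv; apply: dfn_and.
    by apply: (curve_dfn cg); dterm_tac.
  by apply: (map_graph_def hf); dterm_tac.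
have dT i : def1 S (fun t => exists u, G i t u).
  by move=> N g dg; apply: dfn_exv; apply: dG; dterm_tac.
have [i FT] : exists i, iend e I (fun t => exists u, G i t u).
  apply: (iend_pigeonhole oI dT); apply: (@filterS _ _ FF) (iend_itv e oI) => t tI.
  have [x Lx fx] := fibre t tI; have [i xi] := dcover x.
  by exists i, (dchart i x); split=> //; exists x.
have dT1 : definable S [set z : 'rV[M]_1 | exists u, G i (z ord0 ord0) u].
  by have /def1P := dT i.
have dG1 : definable S [set z : 'rV[M]_(1 + ddim i) |
    G i (lsubmx z ord0 ord0) (rsubmx z)].
  by apply: dG; dterm_tac.
have [|h [dh hG]] := sk _ _ _ _ dT1 dG1.
  by move=> t [u Gu]; exists u; rewrite /= row_mxKl row_mxKr.
have {}hG t u : G i t u -> G i t (h (const_mx t)).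
  move=> Gu; have := hG (const_mx t); rewrite /= row_mxKl row_mxKr mxE.
  by apply; exists u.
have dgr N (g : 'rV[M]_N -> M) (u : 'rV[M]_N -> 'rV[M]_(ddim i)) :
    dterm g -> dvec u ->
    dfn S (fun z => (exists v, G i (g z) v) /\ h (const_mx (g z)) = u z).
  move=> dg du; apply: dfn_ext (dfn_mem dh (dvec_row (dvec_const dg) du)) => z; split.
    by move=> [t Tt /eq_row_mx[et <-]]; move: Tt; rewrite et /= mxE.
  by move=> [Tg <-]; exists (const_mx (g z)) => //=; rewrite mxE.
have [_ [a0 _]] := oI.
(* the coordinates of [h], made total by the arbitrary value [a0] *)
pose hk k t := if pselect (exists u, G i t u) then h (const_mx t) ord0 k else a0.
have dhk k : deff S (hk k).
  move=> N g a dg da.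
  apply: (@dfn_ext _ _ _ _ (fun z => (exists u, ((exists v, G i (g z) v) /\
     h (const_mx (g z)) = u) /\ u ord0 k = a z) \/
     (~ (exists v, G i (g z) v) /\ a0 = a z))).
    move=> z; rewrite /hk; case: pselect => [Tz|nT]; split.
    - by move=> [[u [[_ ->]]]|[]].
    - by move=> hz; left; exists (h (const_mx (g z))).
    - by move=> [[u [[]]]|[]].
    - by right.
  apply: dfn_or; last first.
    apply: dfn_and; first by apply: dfn_not; apply: (dfn_def1 (dT i)).
    by apply: dfn_eq; dterm_tac.
  apply: dfn_exv; apply: dfn_and; first by apply: dgr; dterm_tac.
  by apply: dfn_eq; dterm_tac.
have Fc : iend e I (fun t => forall k, cont_at (hk k) t).
  by apply: (@filter_forall _ _ _ _ FF) => k; exact: (continuous_iend omin e (dhk k) oI).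
have [J [_ [oJ _ sub eq _]]] := iend_shrink omin oI (filterI FT Fc).
have [beta bP] : exists beta : M -> X, forall t, t \in J ->
    [/\ L (beta t), ddom i (beta t), dchart i (beta t) = h (const_mx t) &
      f (beta t) = gamma t].
  have [x0 _ _] := fibre _ (svalP (cid oI.2)).
  have /boolp.choice[beta bP] : forall t, exists x : X, t \in J ->
    [/\ L x, ddom i x, dchart i x = h (const_mx t) & f x = gamma t].
    move=> t; have [tJ|tJ] := boolP (t \in J); last by exists x0.
    have [tI [[u Gu] _]] := sub t tJ; have [_ [x xP]] := hG t u Gu.
    by exists x.
  by exists beta.
exists J, beta; split=> //; [by move=> t /sub[]| |by move=> t /bP[]].
split; first by move=> t /bP[].
  apply/subspace_continuousP => t tJ; have [Lt ti et ft] := bP t tJ.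
  apply/(cvg_chart (within_filter _ (nbhs_filter t)) _ ti); split.
    by apply: (@filterE _ (nbhs t)) => s /= /bP[].
  apply: cvg_rV => k; have [_ [Tt /(_ k)/(cont_atP omin) ck]] := sub t tJ.
  rewrite et; have -> : h (const_mx t) ord0 k = hk k t by rewrite /hk; case: pselect.
  move=> U /ck; apply: (@filterS _ (nbhs t)) => s Us sJ /=.
  have [_ _ -> _] := bP s sJ; move: Us; rewrite /= /hk; case: pselect => // nT.
  by have [_ []] := sub s sJ.
move=> j; have dn : dfn S (fun z : 'rV[M]_(1 + ddim j) => lsubmx z ord0 ord0 \in J /\
    exists u, ((exists v, G i (lsubmx z ord0 ord0) v) /\
        h (const_mx (lsubmx z ord0 ord0)) = u) /\
      exists x, [/\ @ddom _ _ _ X i x, ddom j x, dchart i x = u & dchart j x = rsubmx z]).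
  apply: dfn_and; first by apply: (dfn_def1 (@def1_itv _ _ _ _)); dterm_tac.
  apply: dfn_exv; apply: dfn_and; first by apply: dgr; dterm_tac.
  by apply: (map_graph_def (hom_id X)); dterm_tac.
apply: definable_ext dn => z; split.
  move=> [tJ [u [[_ <-] [x [xi xj ex ez]]]]]; have [_ bi eb _] := bP _ tJ.
  have xb : x = beta (lsubmx z ord0 ord0) by apply: (dchart_inj xi bi); rewrite ex.
  subst x; exists (lsubmx z ord0 ord0) => //; rewrite ez -[RHS]hsubmxK; congr row_mx.
  by apply/rowP => k; rewrite mxE (ord1 k).
move=> [t [tJ tj] <-]; rewrite /= row_mxKl row_mxKr mxE; split=> //.
have [_ bi eb _] := bP _ tJ; have [_ [Tt _]] := sub t tJ.
by exists (h (const_mx t)); split=> //; exists (beta t).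
Qed.

(** The preimage [L] of [K] in [X] is definably compact; a curve in [K] pulled back to
    the range of [f] lifts to [L] near the end, and the limit of the lift is mapped
    to the required limit. *)
Lemma proper_range X Y Z (f : dhom X Y) (g : dhom Y Z) : definable_skolem S ->
  definably_proper (g \o f) -> definably_proper (g \o sub_val (D := range_dset f)).
Proof.
move=> sk [hgf pgf]; apply: (proper_intro omin).
  exact: (hom_comp (@hom_sub_val _ _ _ _ _) (homP g)).
move=> K cK I sigma e z oI cs _ Kz cz.
have cg := curve_comp (D := setT) (@hom_sub_val _ _ _ _ _) cs (fun _ _ => Logic.I).
have [dL cL] := pgf K cK.
have [|J [beta [oJ JI eq cb fb]]] := curve_lift_near_end e sk (homP f) dL oI cg.
  move=> t tI; have [x _ fx] := sub_valP (sigma t); exists x => //=.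
  by have [h _ _] := cs; rewrite /= fx; exact: h.
have [x Lx cx] := (compactP omin _).1 cL J beta oJ cb e.
exists (corestrict f x) => //.
have FF := iend_filter omin e oJ.
apply/(iend_shrink_cvg _ _ eq); apply/(cvg_dsub FF).
apply: (cvg_iend_near omin oJ fb).
exact: cvg_comp cx ((homP f).1 x).
Qed.

Lemma locally_closed_open X (V : set X) : open V -> locally_closed V.
Proof. by move=> oV; exists V, setT; rewrite setIT; split=> //; exact: closedT. Qed.

End Skolem.

(** * Properties of definably proper morphisms *)

Theorem corollary3p13 (d : Order.disp_t) (M : orderTopologicalType d)
    (S : fo_structure M) (omin : o_minimal S) (A : defspace S -> Prop)
    (A_compact_closed : forall (X : defspace S) (K : dset X),
       A X -> definably_compact K -> closed (K : set X))
    (A_locally_closed : forall (X : defspace S) (D : dset X),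
       A X -> locally_closed D -> A (dsub D))
    (A_prod : forall X Y : defspace S, A X -> A Y -> A (dprod X Y)) :
  (* (1) *)
  (forall (X Y : defspace S) (f : dhom X Y), A X -> A Y ->
     closed_immersion f -> definably_proper f) /\
  (* (2) *)
  (forall (X Y Z : defspace S) (f : dhom X Y) (g : dhom Y Z), A X -> A Y -> A Z ->
     definably_proper f -> definably_proper g -> definably_proper (g \o f)) /\
  (* (3) *)
  (forall (X Y Z Z' : defspace S) (p : dhom X Z) (q : dhom Y Z) (f : dhom X Y)
     (r : dhom Z' Z) (qf : q \o f =1 p), A X -> A Y -> A Z -> A Z' ->
     definably_proper f ->
     definably_proper
       (fiber_map qf (frefl r : r \o idfun =1 r) : fiber_prod p r -> fiber_prod q r)) /\
  (* (4) *)
  (forall (X Y X' Y' Z : defspace S)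
     (p : dhom X Z) (q : dhom Y Z) (f : dhom X Y) (qf : q \o f =1 p)
     (p' : dhom X' Z) (q' : dhom Y' Z) (f' : dhom X' Y') (qf' : q' \o f' =1 p'),
     A X -> A Y -> A X' -> A Y' -> A Z ->
     definably_proper f -> definably_proper f' ->
     definably_proper
       (fiber_map qf qf' : fiber_prod p p' -> fiber_prod q q')) /\
  (* (5) *)
  (forall (X Y Z : defspace S) (f : dhom X Y) (g : dhom Y Z), A X -> A Y -> A Z ->
     definably_proper (g \o f) ->
     definably_proper f /\
     (definable_skolem S ->
        definably_proper (g \o sub_val (D := range_dset f)))) /\
  (* (6) *)
  (forall (X Y : defspace S) (f : dhom X Y), A X -> A Y ->
     (definably_proper f <->
      exists (n : nat) (V : 'I_n -> dset Y),
        [/\ forall i, open (V i : set Y),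
            [set: Y] = \bigcup_i (V i : set Y) &
            forall i, definably_proper
              (restrict_over f (V i))])).
Proof.
have cc X : A X -> compacts_closed X by move=> AX K; exact: A_compact_closed.
split; [|split; [|split; [|split; [|split]]]].
- by move=> X Y f _ _; exact: proper_closed_immersion.
- by move=> X Y Z f g _ _ _; exact: proper_comp.
- move=> X Y Z Z' p q f r qf AX AY AZ AZ' pf.
  apply: (proper_fiber_map omin qf (frefl r : r \o idfun =1 r) (cc _ AY) (cc _ AZ') pf).
  exact: proper_id.
- move=> X Y X' Y' Z p q f qf p' q' f' qf' _ AY _ AY' _.
  exact: (proper_fiber_map omin qf qf' (cc _ AY) (cc _ AY')).
- move=> X Y Z f g _ AY AZ pgf; split.
    exact: (proper_cancel omin (cc _ AY) (cc _ AZ) pgf).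
  by move=> sk; exact: proper_range.
move=> X Y f AX AY; split=> [pf|[n [V [oV VT pV]]]].
  have dT : is_definable [set: Y] by move=> i; rewrite setTI; exact: ddef.
  exists 1, (fun=> DSet dT); split.
  - by move=> _; exact: openT.
  - by apply/seteqP; split=> // y _; exists ord0.
  - by move=> _; exact: proper_restrict.
apply: (proper_local omin (cc _ AY) _ oV VT pV) => i.
apply: cc; apply: A_locally_closed => //; exact: locally_closed_open.
Qed.
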